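(* Let $k\ge1$, $0\le i\le k$, and let $D=(d_1,\dots,d_{k+1})$ with $d_j=\delta_{i+1,j}$. Then $L^D\cong L_{i,k}$ as $\widehat{\mathfrak{sl}}_2$-modules.
   Context: $\widehat{\mathfrak{sl}}_2=\mathfrak{sl}_2\otimes\mathbb C[z,z^{-1}]\oplus\mathbb Cc$, $x_i=x\otimes z^i$, $c$ central, $[x_i,y_j]=[x,y]_{i+j}-i\delta_{i+j,0}(x,y)c$, $(x,y)=\mathrm{tr}(xy)$; $e,f,h$ is the standard basis of $\mathfrak{sl}_2$. For $0\le i\le k$, $L_{i,k}$ is the irreducible $\widehat{\mathfrak{sl}}_2$-module generated by a vector $v_{i,k}$ with $e_{\le 0}v_{i,k}=f_{<0}v_{i,k}=h_{<0}v_{i,k}=0$, $c\,v_{i,k}=kv_{i,k}$, $h_0v_{i,k}=iv_{i,k}$. The fermionic space $F$: let $\psi(i),\phi(i)$, $i\in\mathbb Z$, be mutually anticommuting variables with zero squares. $F$ has basis the semi-infinite monomials $\dots\psi(N-1)\phi(N-1)\psi(N)\phi(N)\,\psi(i_1)\cdots\psi(i_s)\,\phi(j_1)\cdots\phi(j_t)$, $N<i_1<\dots<i_s$, $N<j_1<\dots<j_t$. $\psi(i),\phi(i)$ act by right multiplication, $\psi^*(i),\phi^*(i)$ by (right) differentiation with respect to $\psi(-i),\phi(-i)$, so $[\psi^*(i),\psi(j)]_+=[\phi^*(i),\phi(j)]_+=\delta_{i+j,0}$ and all other anticommutators vanish. $\widehat{\mathfrak{sl}}_2$ acts on $F$ with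 $c=1$ by $e(z)=\sum_ie_iz^i=\psi(z)\phi(z)$, $f(z)=\sum_if_iz^i=\phi^*(z)\psi^*(z)$ (where $a(z)=\sum_ia(i)z^i$), with $h_i$ determined by the commutation relations. $F^{\otimes k}$ is then a level $k$ module. Put $v(2N)=\dots\psi(N-1)\phi(N-1)\psi(N)$, $v(2N+1)=\dots\psi(N-1)\phi(N-1)\psi(N)\phi(N)$. Definition of $L^D$ for $D\in\mathbb Z_{\ge0}^{k+1}$, $d_{k+1}\in\{0,1\}$: let $n=d_1+\cdots+d_{k+1}$ and $\beta_i=d_{i+1}+\cdots+d_{k+1}$, $i=1,\dots,k$. For $s\ge1$ put $$w_s=v(-\beta_1-2s)\otimes\cdots\otimes v(-\beta_k-2s),\qquad M_s=\mathbb C[e_{-(n+2s)+1},\dots,e_{-1},e_0]\,w_s\subset F^{\otimes k}.$$ These form an increasing chain and $L^D=\bigcup_{s\ge1}M_s$, which is an $\widehat{\mathfrak{sl}}_2$-submodule of $F^{\otimes k}$. *)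

(* Defs.v *)
From HB Require Import structures.
From mathcomp Require Import all_boot all_order all_algebra.
From mathcomp Require Import finmap.
From mathcomp Require Import boolp classical_sets fsbigop.
From mathcomp Require Export reals complex.
From mathcomp Require Import monalg.

Set Implicit Arguments.
Unset Strict Implicit.
Unset Printing Implicit Defensive.
Import Order.TTheory GRing.Theory Num.Theory.
Local Open Scope ring_scope.

(** * The Lie algebra sl_2 *)

Section Sl2.
Variable K : fieldType.

Definition traceless : {pred 'M[K]_2} := [pred x | \tr x == 0].

Fact traceless_submod_closed : submod_closed traceless.
Proof.
split=> [|a x y]; first by rewrite inE mxtrace0.
by rewrite !inE mxtraceD mxtraceZ => /eqP-> /eqP->; rewrite mulr0 addr0.
Qed.
HB.instance Definition _ :=
  GRing.isSubmodClosed.Build K 'M[K]_2 traceless traceless_submod_closed.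

Record sl2 := Sl2 { sl2_mx :> 'M[K]_2; sl2P : sl2_mx \in traceless }.
HB.instance Definition _ := [isSub for sl2_mx].
HB.instance Definition _ := [Choice of sl2 by <:].
HB.instance Definition _ := [SubChoice_isSubLmodule of sl2 by <:].

Fact sl2_bracket_subproof (x y : sl2) :
  (x : 'M_2) *m y - (y : 'M_2) *m x \in traceless.
Proof. by rewrite inE raddfB /= mxtrace_mulC subrr. Qed.
Definition sl2_bracket (x y : sl2) : sl2 := Sl2 (sl2_bracket_subproof x y).

Definition sl2_form (x y : sl2) : K := \tr ((x : 'M_2) *m y).

Fact sl2_e_subproof : (delta_mx 0 1 : 'M[K]_2) \in traceless.
Proof. by rewrite inE /mxtrace 2!big_ord_recl big_ord0 !mxE /= !addr0. Qed.
Definition sl2_e : sl2 := Sl2 sl2_e_subproof.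

Fact sl2_f_subproof : (delta_mx 1 0 : 'M[K]_2) \in traceless.
Proof. by rewrite inE /mxtrace 2!big_ord_recl big_ord0 !mxE /= !addr0. Qed.
Definition sl2_f : sl2 := Sl2 sl2_f_subproof.

Fact sl2_h_subproof :
  (delta_mx 0 0 - delta_mx 1 1 : 'M[K]_2) \in traceless.
Proof.
by rewrite inE /mxtrace 2!big_ord_recl big_ord0 !mxE /= subr0 add0r addr0 subrr.
Qed.
Definition sl2_h : sl2 := Sl2 sl2_h_subproof.

End Sl2.

(** * Modules over the affine Lie algebra *)

(* As the affine algebra is the direct sum of the sl_2 (x) z^n and of C c, an
   action is given by the operators [loop x n] of x_n = x (x) z^n and by the
   operator [cent] of c; [is_module] says that they define a representation. *)

Section AffineModules.
Variable K : fieldType.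

Record action (V : lmodType K) := Action {
  loop : sl2 K -> int -> V -> V;
  cent : V -> V }.

Record is_module (V : lmodType K) (A : action V) : Prop := IsModule {
  loop_linear : forall x n, linear (loop A x n);
  cent_linear : linear (cent A);
  loop_linear_sl2 : forall n v, linear (fun x => loop A x n v);
  cent_central : forall x n v, cent A (loop A x n v) = loop A x n (cent A v);
  loop_bracket : forall x y i j v,
    loop A x i (loop A y j v) - loop A y j (loop A x i v) =
      loop A (sl2_bracket x y) (i + j) v
      - (i%:~R * (i + j == 0)%:R * sl2_form x y) *: cent A v }.

Record is_submodule (V : lmodType K) (A : action V) (W : V -> Prop) : Prop :=
  IsSubmodule {
    submodule0 : W 0;
    submoduleD : forall u v, W u -> W v -> W (u + v);
    submoduleZ : forall a v, W v -> W (a *: v);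
    submodule_loop : forall x n v, W v -> W (loop A x n v);
    submodule_cent : forall v, W v -> W (cent A v) }.

Definition irreducible (V : lmodType K) (A : action V) : Prop :=
  (exists v : V, v <> 0) /\
  forall W : V -> Prop, is_submodule A W ->
    (forall v, W v -> v = 0) \/ (forall v, W v).

Definition generated_by (V : lmodType K) (A : action V) (v : V) : Prop :=
  forall W : V -> Prop, is_submodule A W -> W v -> forall u, W u.

(* (V, A) is a copy of L_{i,k}. *)
Definition is_L (i k : nat) (V : lmodType K) (A : action V) : Prop :=
  [/\ is_module A, irreducible A &
    exists v : V,
      [/\ generated_by A v,
          forall n : int, n <= 0 -> loop A (sl2_e K) n v = 0,
          forall n : int, n < 0 ->
            loop A (sl2_f K) n v = 0 /\ loop A (sl2_h K) n v = 0,
          cent A v = k%:R *: v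
        & loop A (sl2_h K) 0 v = i%:R *: v]].

(* An isomorphism of (V, A) with the subspace L of (W, B); it makes L a
   submodule when (V, A) is a module. *)
Definition iso_onto (V W : lmodType K) (A : action V) (B : action W)
    (L : W -> Prop) : Prop :=
  exists g : {linear V -> W},
    [/\ injective g,
        forall x n v, g (loop A x n v) = loop B x n (g v),
        forall v, g (cent A v) = cent B (g v)
      & forall w, L w <-> exists v, w = g v].

Definition lin_ext (S : choiceType) (V : lmodType K) (f : S -> V)
  (v : {malg K[S]}) : V := \sum_(s <- msupp v) v@_s *: f s.

End AffineModules.

(** * Semi-infinite monomials *)

(* The variables are numbered by the integers, psi(i) being number 2i and
   phi(i) number 2i+1. A semi-infinite monomial, up to sign, is the set of the
   numbers of its factors, which differs from {n | n < 0} by a finite set; this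
   finite symmetric difference encodes it. The basis vector is the product of
   the factors in increasing order, ... psi(i) phi(i) psi(i+1) phi(i+1) ... *)
Definition state : choiceType := {fset int}.

Definition occupied (S : state) (n : int) : bool := (n \in S) (+) (n < 0).

Definition toggle (S : state) (n : int) : state :=
  if n \in S then (S `\ n)%fset else (n |` S)%fset.

(* A number congruent mod 2 to the number of factors of S with number > n:
   the first term counts those of the symmetric difference, the second one
   the m such that n < m < 0. *)
Definition crossings (S : state) (n : int) : nat :=
  (count (fun m : int => (n < m)%R) S + (if (n < 0)%R then `|n|.-1 else 0))%N.

(* v(m): the factors are those with number <= m. *)
Definition vac_state (m : int) : state :=
  match m with
  | Posz a => [fset Posz j | j in iota 0 a.+1]%fset
  | Negz a => [fset Negz j | j in iota 0 a]%fset
  end.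

Lemma occupied_vac (m n : int) : occupied (vac_state m) n = (n <= m).
Proof.
rewrite /occupied /vac_state; case: m => a.
- case: n => b.
    rewrite (_ : (Posz b < 0) = false) // addbF lez_nat.
    apply/imfsetP/idP => [[j]|le_ba].
      by rewrite -[in_mem _ _]/(j \in iota 0 a.+1) mem_iota add0n ltnS => lt_ja [->].
    by exists b => //; rewrite -[in_mem _ _]/(b \in iota 0 a.+1) mem_iota.
  by rewrite (_ : (Negz b \in _) = false) //; apply/negP => /imfsetP[].
- case: n => b.
    by rewrite (_ : (Posz b \in _) = false) //; apply/negP => /imfsetP[].
  rewrite (_ : (Negz b < 0) = true) // addbT (_ : (Negz b <= Negz a) = (a <= b)%N) //.
  rewrite leqNgt; congr negb; apply/imfsetP/idP => [[j]|lt_ba].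
    by rewrite -[in_mem _ _]/(j \in iota 0 a) mem_iota add0n => lt_ja [->].
  by exists b => //; rewrite -[in_mem _ _]/(b \in iota 0 a) mem_iota.
Qed.

(** * The fermionic space and the spaces L^D *)

Section Fermions.
Variable K : fieldType.

Definition F : lmodType K := {malg K[state]}.

(* Right multiplication by the variable number n. *)
Definition create (n : int) : F -> F := lin_ext (fun S : state =>
  if occupied S n then 0 else (-1) ^+ crossings S n *: << toggle S n >> : F).

(* Right differentiation with respect to the variable number n. *)
Definition annihilate (n : int) : F -> F := lin_ext (fun S : state =>
  if occupied S n then (-1) ^+ crossings S n *: << toggle S n >> : F else 0).

Definition psi (i : int) : F -> F := create (2 * i).
Definition phi (i : int) : F -> F := create (2 * i + 1).
Definition psi_star (i : int) : F -> F := annihilate (2 * - i).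
Definition phi_star (i : int) : F -> F := annihilate (2 * - i + 1).

(* Coefficients of the products psi(z) phi(z) and phi^*(z) psi^*(z) of operator
   valued series; the sums have finite support for every v. *)
Definition eF (i : int) (v : F) : F :=
  \sum_(a \in [set: int]%classic) psi a (phi (i - a) v).
Definition fF (i : int) (v : F) : F :=
  \sum_(a \in [set: int]%classic) phi_star a (psi_star (i - a) v).

(* The commutation relations give [e_i, f_0] = h_i. *)
Definition hF (i : int) (v : F) : F := eF i (fF 0 v) - fF 0 (eF i v).

Definition F_action : action F := {|
  loop := fun x n v => (x : 'M_2) 0 1 *: eF n v + (x : 'M_2) 1 0 *: fF n v
                       + (x : 'M_2) 0 0 *: hF n v;
  cent := fun v => v |}.

(* The k-th tensor power of F: T stands for T_1 (x) ... (x) T_k. *)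
Definition Ftensor (k : nat) : lmodType K := {malg K[{ffun 'I_k -> state}]}.

(* X acting on the j-th factor. *)
Definition on_factor (k : nat) (j : 'I_k) (X : F -> F) :
    Ftensor k -> Ftensor k :=
  lin_ext (fun T : {ffun 'I_k -> state} =>
    lin_ext (fun S : state =>
        << [ffun l => if l == j then S else T l] >> : Ftensor k)
      (X << T j >>)).

Definition tensor_action (k : nat) : action (Ftensor k) := {|
  loop := fun x n v => \sum_(j < k) on_factor j (loop F_action x n) v;
  cent := fun v => \sum_(j < k) on_factor j (cent F_action) v |}.

(* D j is d_{j+1}. *)
Section LD.
Variables (k : nat) (D : 'I_k.+1 -> nat).

Definition LD_n : nat := \sum_(j < k.+1) D j.

(* LD_beta j is beta_{j+1} = d_{j+2} + ... + d_{k+1}. *)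
Definition LD_beta (j : 'I_k) : nat := \sum_(l < k.+1 | (j < l)%N) D l.

Definition LD_w (s : nat) : Ftensor k :=
  << [ffun j => vac_state (- (LD_beta j)%:Z - (2 * s)%:Z)] >>.

Definition e_monomial (l : seq int) (w : Ftensor k) : Ftensor k :=
  foldr (loop (tensor_action k) (sl2_e K)) w l.

(* Linear combinations of monomials in e_{-(n+2s)+1}, ..., e_0 applied to w_s. *)
Definition LD_M (s : nat) (u : Ftensor k) : Prop :=
  exists p : seq (K * seq int),
    (forall m, m \in p ->
       all (fun a : int => (- (LD_n + 2 * s)%:Z + 1 <= a <= 0)%R) m.2) /\
    u = \sum_(m <- p) m.1 *: e_monomial m.2 (LD_w s).

Definition LD (u : Ftensor k) : Prop := exists2 s : nat, (1 <= s)%N & LD_M s u.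

End LD.
End Fermions.

(* Main.v *)
Require Import Defs.
From HB Require Import structures.
From mathcomp Require Import all_boot all_order all_algebra.
From mathcomp Require Import finmap.
From mathcomp Require Import boolp classical_sets fsbigop.
From mathcomp Require Import monalg.
From mathcomp Require Import ring zify.

(** Why the theorem is true.

    The space L^D for d_j = delta_{i+1,j} is itself an irreducible highest
    weight module of type (i, k) ([LD_is_L]), and such a module is unique up to
    isomorphism ([L_unique]); both claims follow.

    Uniqueness. Let v and w be the highest weight vectors of two such modules.
    By the usual argument on the submodule U of the direct sum generated by
    (v, w), it suffices that (0, w) is not in U. The monomials in the simple
    raising operators f_0 and e_1 applied to (v, w) span U
    ([mon_span_submodule]). The algebra contains no derivation, so these
    monomials have to be separated by other means: the Sugawara operator,
    combined with h_0, multiplies a monomial of length r by 2(k+2)r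
    ([pdegree_mon]). On a given finite set of monomials it agrees with a finite
    sum of products of algebra elements, hence it preserves submodules, and it
    isolates the component of degree 0 of any element of U
    ([leading_component]). As (0, w) has degree 0, it would be a multiple of
    (v, w), which is absurd. The nonvanishing of k + 2 is essential here.

    Fermions. Commutators with the fermions and the value at one vector
    determine an operator on F ([eq_scalar_of_commuting]). This gives the
    relations of the affine algebra, the central term coming from the vector
    v(i). The positive modes, whose values at the v(m) are less simple, are
    reached through the Hermitian form for which the monomials are orthonormal:
    e_n is adjoint to f_{-n} ([e_f_adjoint]).

    The vectors v(m_1) (x) ... (x) v(m_k) are extremal. If all m_j <= p, the
    highest nonzero power of e_p maps such a vector to a nonzero multiple of the
    one with m_j replaced by 2p - m_j ([reflect_E]), and sl_2-theory inverts
    this with powers of f_{-p} ([string_down]). All that has to be known about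
    the w_s is an instance of it: w_s is obtained from w_{s+1} with p = -2s-2 and
    then p = -2s-1; the highest weight vector v(1)^{(x) i} (x) v(0)^{(x) (k-i)}
    from w_0 with p = 0; and e_1 w_s is f_{-1}^{N-1} e_1^N w_s up to a scalar,
    where e_1^N w_s is also a multiple of e_0^{N'} w_{s+1}. Since f_n kills w_s
    and h_n acts on it by a scalar for n <= 0, L^D is stable under all modes
    n <= 0; the last instance gives stability under e_1, hence under everything
    ([LD_submodule]). Irreducibility follows from the positivity of the Hermitian
    form and the same isolation of the degree 0 component
    ([LD_irreducible]). *)

Set Implicit Arguments.
Unset Strict Implicit.
Unset Printing Implicit Defensive.
Import Order.TTheory GRing.Theory Num.Theory.
Local Open Scope ring_scope.

(** * Linear maps as a property of functions *)
Section LinearProp.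
Variables (K : fieldType) (U V : lmodType K) (f : U -> V).
Hypothesis lf : linear f.

Lemma lin0 : f 0 = 0.
Proof. by have := lf (-1) 0 0; rewrite addr0 !scaleN1r addNr oppr0. Qed.
Lemma linD u v : f (u + v) = f u + f v.
Proof. by have := lf 1 u v; rewrite !scale1r. Qed.
Lemma linZ a u : f (a *: u) = a *: f u.
Proof. by have := lf a u 0; rewrite !addr0 lin0 addr0. Qed.
Lemma linN u : f (- u) = - f u.
Proof. by rewrite -!scaleN1r linZ. Qed.
Lemma linB u v : f (u - v) = f u - f v.
Proof. by rewrite linD linN. Qed.
Lemma lin_sum I (r : seq I) (P : pred I) (g : I -> U) :
  f (\sum_(i <- r | P i) g i) = \sum_(i <- r | P i) f (g i).
Proof. exact: (big_morph f linD lin0). Qed.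
End LinearProp.

Section LinearBuild.
Variable K : fieldType.

Lemma lin_id (V : lmodType K) : linear (fun v : V => v).
Proof. by []. Qed.
Lemma lin_comp (U V W : lmodType K) (f : V -> W) (g : U -> V) :
  linear f -> linear g -> linear (fun u => f (g u)).
Proof. by move=> lf lg a u v; rewrite lg lf. Qed.
Lemma lin_add (V W : lmodType K) (f g : V -> W) :
  linear f -> linear g -> linear (fun u => f u + g u).
Proof. by move=> lf lg a u v; rewrite lf lg scalerDr addrACA. Qed.
Lemma lin_scale (V W : lmodType K) (f : V -> W) c :
  linear f -> linear (fun u => c *: f u).
Proof. by move=> lf a u v; rewrite lf scalerDr !scalerA mulrC. Qed.
Lemma lin_opp (V W : lmodType K) (f : V -> W) :
  linear f -> linear (fun u => - f u).
Proof. by move=> lf a u v; rewrite lf opprD scalerN. Qed.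
Lemma lin_sub (V W : lmodType K) (f g : V -> W) :
  linear f -> linear g -> linear (fun u => f u - g u).
Proof. by move=> lf lg; apply: lin_add => //; apply: lin_opp. Qed.
Lemma lin_bigsum (V W : lmodType K) I (r : seq I) (f : I -> V -> W) :
  (forall i, linear (f i)) -> linear (fun u => \sum_(i <- r) f i u).
Proof.
move=> lf a u v; rewrite scaler_sumr -big_split; apply: eq_bigr => i _.
exact: lf.
Qed.

Lemma lin_iter (V : lmodType K) (X : V -> V) r : linear X -> linear (iter r X).
Proof. by move=> lX; elim: r => [|r IH] // a u v; rewrite !iterS IH lX. Qed.
End LinearBuild.

(** * Linear identities by comparison of coefficients *)
Section LmodReflection.
Variables (K : fieldType) (V : lmodType K).

(** Formal linear combinations of the entries of an environment: an identity
    between two of them holds once the coefficients of each entry agree, which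
    leaves identities in the field for [ring]. *)
Inductive lexp :=
  LVar of nat | LZero | LAdd of lexp & lexp | LOpp of lexp | LScale of K & lexp.

Fixpoint leval (env : seq V) (e : lexp) : V :=
  match e with
  | LVar n => env`_n
  | LZero => 0
  | LAdd a b => leval env a + leval env b
  | LOpp a => - leval env a
  | LScale c a => c *: leval env a
  end.

Fixpoint lcoef (e : lexp) (i : nat) : K :=
  match e with
  | LVar n => if n == i then 1 else 0
  | LZero => 0
  | LAdd a b => lcoef a i + lcoef b i
  | LOpp a => - lcoef a i
  | LScale c a => c * lcoef a i
  end.

Fixpoint lwf (n : nat) (e : lexp) : bool :=
  match e with
  | LVar m => (m < n)%N
  | LZero => true
  | LAdd a b => lwf n a && lwf n b
  | LOpp a => lwf n a
  | LScale c a => lwf n a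
  end.

Lemma levalE env e : lwf (size env) e ->
  leval env e = \sum_(i < size env) lcoef e i *: env`_i.
Proof.
elim: e => [n|| a IHa b IHb|a IHa|c a IHa] /= wf.
- rewrite (bigD1 (Ordinal wf)) //= eqxx scale1r big1 ?addr0 // => i ni.
  by rewrite ifF ?scale0r //; apply: contraNF ni => /eqP e; apply/eqP/val_inj.
- by rewrite big1 // => i _; rewrite scale0r.
- case/andP: wf => wa wb; rewrite IHa // IHb // -big_split /=.
  by apply: eq_bigr => i _; rewrite scalerDl.
- by rewrite IHa // -sumrN; apply: eq_bigr => i _; rewrite scaleNr.
- by rewrite IHa // scaler_sumr; apply: eq_bigr => i _; rewrite scalerA.
Qed.

Fixpoint lcoefs_eq (a b : lexp) (n : nat) : Prop :=
  if n is m.+1 then lcoef a m = lcoef b m /\ lcoefs_eq a b m else True.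

Lemma lmod_reflect env a b : lwf (size env) a && lwf (size env) b ->
  lcoefs_eq a b (size env) -> leval env a = leval env b.
Proof.
case/andP=> wa wb eqab; rewrite !levalE //; apply: eq_bigr => i _; congr (_ *: _).
have: forall n, lcoefs_eq a b n -> forall i, (i < n)%N -> lcoef a i = lcoef b i.
  elim=> [//|n IH] /= [e1 e2] j; rewrite ltnS leq_eqVlt => /orP[/eqP->//|].
  exact: IH.
by apply; [exact: eqab | exact: ltn_ord].
Qed.
End LmodReflection.

Ltac lmod_find x env :=
  match env with
  | x :: _ => constr:(0%N)
  | _ :: ?r => let n := lmod_find x r in constr:(S n)
  end.

Ltac lmod_atoms t env :=
  match t with
  | @Algebra.add _ ?a ?b => let e := lmod_atoms a env in lmod_atoms b e
  | @Algebra.opp _ ?a => lmod_atoms a env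
  | @GRing.scale _ _ _ ?a => lmod_atoms a env
  | @Algebra.zero _ => env
  | _ => match env with
         | _ => let n := lmod_find t env in env
         | _ => constr:(t :: env)
         end
  end.

Ltac lmod_reify K V env t :=
  match t with
  | @Algebra.add _ ?a ?b =>
      let x := lmod_reify K V env a in let y := lmod_reify K V env b in
      constr:(@LAdd K x y)
  | @Algebra.opp _ ?a =>
      let x := lmod_reify K V env a in constr:(@LOpp K x)
  | @GRing.scale _ _ ?c ?a =>
      let x := lmod_reify K V env a in constr:(@LScale K c x)
  | @Algebra.zero _ => constr:(@LZero K)
  | _ => let n := lmod_find t env in constr:(@LVar K n)
  end.

(** Atoms are identified up to syntactic equality, so the arguments of the
    operators on both sides of the goal must be literally the same. *)
Ltac lmod_with K V :=
  match goal with
  | |- @eq _ ?a ?b =>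
    let e0 := constr:(@nil (GRing.Lmodule.sort V)) in
    let e1 := lmod_atoms a e0 in
    let e2 := lmod_atoms b e1 in
    let x := lmod_reify K V e2 a in
    let y := lmod_reify K V e2 b in
    refine (@lmod_reflect K V e2 x y _ _);
    [ reflexivity | cbn [lcoefs_eq lcoef size eqn eq_op]; simpl;
      repeat (apply: conj); try exact I; try by ring ]
  end.

(** * Modules over the affine algebra in coordinates *)
Section Sl2Coords.
Variable K : fieldType.
Local Notation e := (sl2_e K).
Local Notation f := (sl2_f K).
Local Notation h := (sl2_h K).

Lemma sl2_tr (x : sl2 K) : (x : 'M_2) 1 1 = - (x : 'M_2) 0 0.
Proof.
have /eqP := sl2P x; rewrite /mxtrace !big_ord_recl big_ord0 addr0 addrC => /eqP.
rewrite (_ : lift _ _ = 1); last exact/val_inj.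
by rewrite addr_eq0 => /eqP.
Qed.

Lemma eq_mx2 (a b : 'M[K]_2) : a 0 0 = b 0 0 -> a 0 1 = b 0 1 ->
  a 1 0 = b 1 0 -> a 1 1 = b 1 1 -> a = b.
Proof.
move=> h00 h01 h10 h11; apply/matrixP => i j.
have ord2 (l : 'I_2) : l = 0 \/ l = 1.
  by case: l => [[|[|l]] hl]; [left|right|by []]; apply: val_inj.
by case: (ord2 i) => ->; case: (ord2 j) => ->.
Qed.

Lemma mul2E (a b : 'M[K]_2) i j : (a *m b) i j = a i 0 * b 0 j + a i 1 * b 1 j.
Proof.
rewrite mxE !big_ord_recl big_ord0 addr0.
by rewrite (_ : lift _ _ = 1) //; apply: val_inj.
Qed.

Lemma sl2_mxD (x y : sl2 K) : (x + y : sl2 K) = (x : 'M_2) + (y : 'M_2) :> 'M_2.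
Proof. by []. Qed.
Lemma sl2_mxZ a (x : sl2 K) : (a *: x : sl2 K) = a *: (x : 'M_2) :> 'M_2.
Proof. by []. Qed.

Lemma sl2_decomp (x : sl2 K) :
  x = (x : 'M_2) 0 1 *: e + (x : 'M_2) 1 0 *: f + (x : 'M_2) 0 0 *: h.
Proof.
apply: val_inj; rewrite -[val]/(@sl2_mx K) !sl2_mxD !sl2_mxZ; apply: eq_mx2;
by rewrite !mxE /= ?sl2_tr; ring.
Qed.

Lemma sl2_formE (x y : sl2 K) : sl2_form x y =
  (x : 'M_2) 0 1 * (y : 'M_2) 1 0 + (x : 'M_2) 1 0 * (y : 'M_2) 0 1
  + (x : 'M_2) 0 0 * (y : 'M_2) 0 0 *+ 2.
Proof.
rewrite /sl2_form /mxtrace !big_ord_recl big_ord0 addr0.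
by rewrite (_ : lift _ _ = 1) ?mul2E ?sl2_tr; [ring|apply: val_inj].
Qed.

Lemma sl2_bracketE (x y : sl2 K) :
  [/\ (sl2_bracket x y : 'M_2) 0 1 =
        2 * ((x : 'M_2) 0 0 * (y : 'M_2) 0 1 - (x : 'M_2) 0 1 * (y : 'M_2) 0 0),
      (sl2_bracket x y : 'M_2) 1 0 =
        2 * ((x : 'M_2) 1 0 * (y : 'M_2) 0 0 - (x : 'M_2) 0 0 * (y : 'M_2) 1 0)
    & (sl2_bracket x y : 'M_2) 0 0 =
        (x : 'M_2) 0 1 * (y : 'M_2) 1 0 - (x : 'M_2) 1 0 * (y : 'M_2) 0 1].
Proof. by split; rewrite mxE [X in _ + X]mxE !mul2E ?sl2_tr; ring. Qed.

Lemma sl2_eE : ((e : 'M_2) 0 1 = 1) * ((e : 'M_2) 1 0 = 0) * ((e : 'M_2) 0 0 = 0).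
Proof. by rewrite /= !mxE. Qed.
Lemma sl2_fE : ((f : 'M_2) 0 1 = 0) * ((f : 'M_2) 1 0 = 1) * ((f : 'M_2) 0 0 = 0).
Proof. by rewrite /= !mxE. Qed.
Lemma sl2_hE : ((h : 'M_2) 0 1 = 0) * ((h : 'M_2) 1 0 = 0) * ((h : 'M_2) 0 0 = 1).
Proof. by rewrite /= !mxE /= subr0 oppr0 addr0. Qed.
End Sl2Coords.

Section FromRelations.
Variables (K : fieldType) (V : lmodType K) (A : action V).
Variables (E F H : int -> V -> V).
Local Notation C := (cent A).
Ltac lmod := lmod_with K V.

Hypothesis loopE : forall x n v, loop A x n v =
  (x : 'M_2) 0 1 *: E n v + (x : 'M_2) 1 0 *: F n v + (x : 'M_2) 0 0 *: H n v.
Hypotheses (lE : forall n, linear (E n)) (lF : forall n, linear (F n))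
  (lH : forall n, linear (H n)) (lC : linear C).
Hypotheses (CE : forall n v, C (E n v) = E n (C v))
  (CF : forall n v, C (F n v) = F n (C v)) (CH : forall n v, C (H n v) = H n (C v)).
Hypotheses (EE : forall i j v, E i (E j v) = E j (E i v))
  (FF : forall i j v, F i (F j v) = F j (F i v))
  (EF : forall i j v, E i (F j v) - F j (E i v) =
     H (i + j) v - (i%:~R * (i + j == 0)%:R) *: C v)
  (HE : forall i j v, H i (E j v) - E j (H i v) = 2 *: E (i + j) v)
  (HF : forall i j v, H i (F j v) - F j (H i v) = - (2 *: F (i + j) v))
  (HH : forall i j v, H i (H j v) - H j (H i v) =
     - (i%:~R * (i + j == 0)%:R * 2) *: C v).

(** The brackets of the basis suffice because both sides of the bracket relation are
    bilinear in the two elements of sl_2. *)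
Lemma is_module_from_relations : is_module A.
Proof.
have lC' := lC.
split=> [x n||n v|x n v|x y i j v].
- move=> a u v; rewrite !loopE lE lF lH; lmod.
- exact: lC.
- by move=> a x y; rewrite !loopE !sl2_mxD !sl2_mxZ !mxE; lmod.
- by rewrite !loopE !(linD lC) !(linZ lC) CE CF CH.
have [b01 b10 b00] := sl2_bracketE x y.
rewrite !loopE b01 b10 b00 sl2_formE.
do ![rewrite (linD (lE _))|rewrite (linD (lF _))|rewrite (linD (lH _))
    |rewrite (linZ (lE _))|rewrite (linZ (lF _))|rewrite (linZ (lH _))].
set d := i%:~R * (i + j == 0)%:R : K.
have jiE : j + i = i + j by rewrite addrC.
have dE : j%:~R * (j + i == 0)%:R = - d :> K.
  rewrite jiE /d; case: eqP => [ij|_]; last by rewrite /= !mulr0n !mulr0 oppr0.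
  by rewrite (_ : j = - i) ?rmorphN ?mulNr //; lia.
have e1 : E i (F j v) = F j (E i v) + (H (i + j) v - d *: C v).
  by rewrite -EF addrC subrK.
have e2 : F i (E j v) = E j (F i v) - (H (i + j) v + d *: C v).
  by have := EF j i v; rewrite dE jiE scaleNr opprK => <-; rewrite subKr.
have e3 : H i (E j v) = E j (H i v) + 2 *: E (i + j) v by rewrite -HE addrC subrK.
have e4 : E i (H j v) = H j (E i v) - 2 *: E (i + j) v by rewrite -jiE -HE subKr.
have e5 : H i (F j v) = F j (H i v) - 2 *: F (i + j) v by rewrite -HF addrC subrK.
have e6 : F i (H j v) = H j (F i v) + 2 *: F (i + j) v.
  by have := HF j i v; rewrite jiE => h; rewrite -[_ *: _]opprK -h subKr.
have e7 : H i (H j v) = H j (H i v) - (d * 2) *: C v.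
  by rewrite -scaleNr -HH addrC subrK.
rewrite e1 e2 e3 e4 e5 e6 e7 (EE i) (FF i).
set a := sl2_mx x 0 1; set b := sl2_mx x 1 0; set c := sl2_mx x 0 0.
set a' := sl2_mx y 0 1; set b' := sl2_mx y 1 0; set c' := sl2_mx y 0 0.
lmod.
Qed.
End FromRelations.

Section Relations.
Variables (K : fieldType) (V : lmodType K) (A : action V).
Hypothesis mA : is_module A.
Local Notation E := (loop A (sl2_e K)).
Local Notation F := (loop A (sl2_f K)).
Local Notation H := (loop A (sl2_h K)).
Local Notation C := (cent A).

Lemma loop_lin x n : linear (loop A x n). Proof. exact: loop_linear. Qed.

Lemma loop_decomp x n v : loop A x n v =
  (x : 'M_2) 0 1 *: E n v + (x : 'M_2) 1 0 *: F n v + (x : 'M_2) 0 0 *: H n v.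
Proof.
have l := loop_linear_sl2 mA n v.
by rewrite {1}[x]sl2_decomp !(linD l) !(linZ l).
Qed.

Lemma loop_comb (z : sl2 K) a b c n v :
  (z : 'M_2) 0 1 = a -> (z : 'M_2) 1 0 = b -> (z : 'M_2) 0 0 = c ->
  loop A z n v = a *: E n v + b *: F n v + c *: H n v.
Proof. by rewrite loop_decomp => -> -> ->. Qed.

Ltac bracket_tac x y :=
  let b01 := fresh in let b10 := fresh in let b00 := fresh in
  have [b01 b10 b00] := sl2_bracketE x y;
  rewrite (loop_bracket mA) (loop_comb _ _ b01 b10 b00) sl2_formE
    !(sl2_eE, sl2_fE, sl2_hE) ?(mulr1, mulr0, mul0r, subr0, sub0r, addr0, add0r,
       scale0r, scale1r, mul0rn, mulr0n, oppr0, subrr).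

Lemma rel_EF i j v : E i (F j v) - F j (E i v) =
  H (i + j) v - (i%:~R * (i + j == 0)%:R) *: C v.
Proof. by bracket_tac (sl2_e K) (sl2_f K). Qed.
Lemma rel_HE i j v : H i (E j v) - E j (H i v) = 2 *: E (i + j) v.
Proof. by bracket_tac (sl2_h K) (sl2_e K). Qed.
Lemma rel_HF i j v : H i (F j v) - F j (H i v) = - (2 *: F (i + j) v).
Proof. by bracket_tac (sl2_h K) (sl2_f K); rewrite mulrN1 scaleNr. Qed.
Lemma rel_EE i j v : E i (E j v) = E j (E i v).
Proof. by apply/eqP; rewrite -subr_eq0; bracket_tac (sl2_e K) (sl2_e K). Qed.
Lemma rel_FF i j v : F i (F j v) = F j (F i v).
Proof. by apply/eqP; rewrite -subr_eq0; bracket_tac (sl2_f K) (sl2_f K). Qed.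

(** The modes e_0, f_0, e_1, f_{-1} are the Chevalley generators: brackets with
    h_1 = [e_1, f_0] and h_{-1} = [e_0, f_{-1}] shift the modes of e and f up and
    down, and dividing by the structure constant 2 reaches all of them. *)
Lemma submodule_gen (W : V -> Prop) :
  W 0 -> (forall u v, W u -> W v -> W (u + v)) -> (forall a v, W v -> W (a *: v)) ->
  (forall v, W v -> W (C v)) ->
  (forall v, W v -> W (E 0 v)) -> (forall v, W v -> W (F 0 v)) ->
  (forall v, W v -> W (E 1 v)) -> (forall v, W v -> W (F (-1) v)) ->
  (2 : K) != 0 ->
  is_submodule A W.
Proof.
move=> W0 WD WZ WC WE0 WF0 WE1 WFN nz2.
have WN v : W v -> W (- v) by rewrite -scaleN1r; apply: WZ.
have WB u v : W u -> W v -> W (u - v) by move=> hu /WN; apply: WD.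
have W2 v : W (2 *: v) -> W v by move/(WZ 2^-1); rewrite scalerA mulVf // scale1r.
pose st (X : V -> V) := forall v, W v -> W (X v).
have stH i j : st (E i) -> st (F j) -> i%:~R * (i + j == 0)%:R = 0 :> K -> st (H (i + j)).
  move=> sE sF z v wv; have := rel_EF i j v; rewrite z scale0r subr0 => <-.
  by apply: WB; [apply/sE/sF|apply/sF/sE].
have H0 : st (H 0) by apply: (stH 0 0); rewrite ?mul0r.
have H1 : st (H 1) by apply: (stH 1 0); rewrite ?mulr0.
have HN : st (H (-1)) by apply: (stH 0 (-1)); rewrite ?mul0r.
have stE i j : st (H i) -> st (E j) -> st (E (i + j)).
  by move=> sH sE v wv; apply: W2; rewrite -rel_HE; apply: WB; [apply/sH/sE|apply/sE/sH].
have stF i j : st (H i) -> st (F j) -> st (F (i + j)).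
  move=> sH sF v wv; apply: W2; rewrite -[_ *: _]opprK -rel_HF; apply: WN.
  by apply: WB; [apply/sH/sF|apply/sF/sH].
have Epos (n : nat) : st (E n%:Z) /\ st (F n%:Z).
  by elim: n => [|n [IHE IHF]] //; rewrite -add1n PoszD; split; [apply: stE|apply: stF].
have Eneg (n : nat) : st (E (- n%:Z)) /\ st (F (- n%:Z)).
  elim: n => [|n [IHE IHF]] //; rewrite -add1n PoszD opprD.
  by split; [apply: stE|apply: stF].
have stEF n : st (E n) /\ st (F n) by case/intP: n.
have stHn n : st (H n).
  rewrite -[n]addr0; apply: stH => //; first by case: (stEF n).
  by rewrite addr0; case: eqP => [->|_]; rewrite ?mul0r ?mulr0.
split=> // x n v wv; rewrite loop_decomp.
have [sE sF] := stEF n.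
exact: WD (WD _ _ (WZ _ _ (sE _ wv)) (WZ _ _ (sF _ wv))) (WZ _ _ (stHn _ _ wv)).
Qed.
End Relations.

(** * Spans and isolation of an eigencomponent *)
Section Span.
Variables (K : fieldType) (V : lmodType K).

Definition subspace (W : V -> Prop) := [/\ W 0,
  forall u v, W u -> W v -> W (u + v) & forall a v, W v -> W (a *: v)].

Variables (I : Type) (g : I -> V).

Definition span_of (u : V) : Prop :=
  exists p : seq (K * I), u = \sum_(m <- p) m.1 *: g m.2.

Lemma span_subspace : subspace span_of.
Proof.
split.
- by exists [::]; rewrite big_nil.
- by move=> _ _ [p ->] [q ->]; exists (p ++ q); rewrite big_cat.
move=> a _ [p ->]; exists [seq (a * m.1, m.2) | m <- p].
by rewrite big_map scaler_sumr; apply: eq_bigr => m _; rewrite scalerA.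
Qed.

Lemma span_gen i : span_of (g i).
Proof. by exists [:: (1, i)]; rewrite big_seq1 scale1r. Qed.

Lemma span_min (W : V -> Prop) : subspace W -> (forall i, W (g i)) ->
  forall u, span_of u -> W u.
Proof.
move=> [W0 WD WZ] Wg u [p ->]; elim: p => [|m p IH]; first by rewrite big_nil.
by rewrite big_cons; apply: (WD) IH; apply: (WZ).
Qed.

Lemma preim_subspace (U : lmodType K) (X : V -> U) (W : U -> Prop) : linear X ->
  [/\ W 0, forall u v, W u -> W v -> W (u + v) & forall a v, W v -> W (a *: v)] ->
  subspace (fun u => W (X u)).
Proof.
move=> lX [W0 WD WZ]; split; first by rewrite (lin0 lX).
  by move=> u v; rewrite (linD lX); apply: WD.
by move=> a v; rewrite (linZ lX); apply: WZ.
Qed.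

Lemma span_stable (X : V -> V) : linear X -> (forall i, span_of (X (g i))) ->
  forall u, span_of u -> span_of (X u).
Proof.
by move=> lX Xg; apply: span_min => //; apply: preim_subspace => //; apply: span_subspace.
Qed.
End Span.

(** Applying [X - c i] to the sum kills the term [b i], multiplies the other
    terms by scalars and [a] by the nonzero number [- c i]; doing so for every
    term in turn leaves a nonzero multiple of [a]. *)
Lemma eigen_filter (K : fieldType) (V : lmodType K) (X : V -> V) (P : V -> Prop)
    (I : eqType) (r : seq I) (c : I -> K) (b : I -> V) (a : V) :
  linear X -> subspace P -> (forall u, P u -> P (X u)) ->
  X a = 0 -> {in r, forall i, c i != 0 /\ X (b i) = c i *: b i} ->
  P (a + \sum_(i <- r) b i) -> P a.
Proof.
move=> lX [P0 PD PZ] PX; elim: r a b => [|i0 r IH] a b Xa rX Pa.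
  by move: Pa; rewrite big_nil addr0.
have [c0 Xb] := rX i0 (mem_head _ _).
have rX' : {in r, forall i, c i != 0 /\ X (b i) = c i *: b i}.
  by move=> i ir; apply: rX; rewrite inE ir orbT.
have PaN : P (- c i0 *: a + \sum_(i <- r) (c i - c i0) *: b i).
  have -> : \sum_(i <- r) (c i - c i0) *: b i =
      \sum_(i <- r) X (b i) - c i0 *: \sum_(i <- r) b i.
    rewrite scaler_sumr -sumrB; apply: eq_big_seq => i /rX'[_ ->].
    by rewrite scalerBl.
  have := PD _ _ (PX _ Pa) (PZ (- c i0) _ Pa).
  rewrite big_cons (linD lX) Xa (linD lX) Xb (lin_sum lX).
  set S1 := \sum_(i <- r) X (b i); set S2 := \sum_(i <- r) b i.
  by rewrite (_ : _ + _ + _ = - c i0 *: a + (S1 - c i0 *: S2)) //; lmod_with K V.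
have : P (- c i0 *: a).
  apply: IH PaN => [|i /rX'[ci Xi]]; first by rewrite (linZ lX) Xa scaler0.
  by rewrite (linZ lX) Xi !scalerA mulrC.
by move/(PZ (- c i0)^-1); rewrite scalerA mulVf ?oppr_eq0 // scale1r.
Qed.

(** * Highest weight vectors and the Sugawara operator *)
Section HighestWeight.
Variables (K : numFieldType) (V : lmodType K) (A : action V) (k i : nat).
Hypothesis mA : is_module A.
Hypothesis level : forall u, cent A u = k%:R *: u.
Local Notation E := (loop A (sl2_e K)).
Local Notation F := (loop A (sl2_f K)).
Local Notation H := (loop A (sl2_h K)).
Ltac lmod := lmod_with K V.

Definition is_hw (v : V) : Prop :=
  [/\ forall n : int, n <= 0 -> E n v = 0,
      forall n : int, n < 0 -> F n v = 0 /\ H n v = 0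
    & H 0 v = i%:R *: v].

Let lE n : linear (E n) := loop_lin mA _ n.
Let lF n : linear (F n) := loop_lin mA _ n.
Let lH n : linear (H n) := loop_lin mA _ n.

Lemma swap_EF m n u : E m (F n u) =
  F n (E m u) + H (m + n) u - (m%:~R * (m + n == 0)%:R * k%:R) *: u.
Proof. by rewrite -scalerA -level -addrA -(rel_EF mA) addrC subrK. Qed.
Lemma swap_HE m n u : H m (E n u) = E n (H m u) + 2 *: E (m + n) u.
Proof. by rewrite -(rel_HE mA) addrC subrK. Qed.
Lemma swap_HF m n u : H m (F n u) = F n (H m u) - 2 *: F (m + n) u.
Proof. by rewrite -(rel_HF mA) addrC subrK. Qed.
(** The simple raising operators for the triangular decomposition in which
    e_n for n <= 0, and f_n, h_n for n < 0, annihilate. *)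
Definition raising (b : bool) : V -> V := if b then E 1 else F 0.
Definition mon (l : seq bool) (v : V) : V := foldr raising v l.

Lemma raising_linear b : linear (raising b).
Proof. by case: b; [exact: lE|exact: lF]. Qed.

Lemma mon_weight v l : is_hw v ->
  exists c : K, H 0 (mon l v) = c *: mon l v.
Proof.
case=> _ _ h0; elim: l => [|[] l [c IH]] /=; first by exists i%:R.
  exists (c + 2); rewrite swap_HE IH (linZ (lE 1)) add0r.
  by rewrite [RHS]scalerDl.
exists (c - 2); rewrite swap_HF IH (linZ (lF 0)) add0r.
by rewrite [RHS]scalerBl.
Qed.

(** The lowering generators e_0 and f_{-1} commute with the raising generators up
    to h_0 and the centre, which act on monomials by scalars. *)
Lemma mon_span_submodule v : is_hw v -> is_submodule A (span_of (mon ^~ v)).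
Proof.
move=> hv; have [E0 FH0 h0] := hv.
have [S0 SD SZ] := span_subspace (mon ^~ v).
have SN u : span_of (mon ^~ v) u -> span_of (mon ^~ v) (- u).
  by rewrite -scaleN1r; apply: SZ.
have Sgen1 b u : span_of (mon ^~ v) u -> span_of (mon ^~ v) (raising b u).
  apply: span_stable => [|l]; first exact: raising_linear.
  exact: (span_gen (mon ^~ v) (b :: l)).
have SH0 u : span_of (mon ^~ v) u -> span_of (mon ^~ v) (H 0 u).
  apply: span_stable => // l; have [c ->] := mon_weight l hv.
  by apply: SZ; apply: span_gen.
apply: (submodule_gen mA) => //.
- by move=> u Su; rewrite level; apply: SZ.
- apply: span_stable => // l; elim: l => [|[] l IH] /=; first by rewrite E0.
    by rewrite (rel_EE mA); apply: (Sgen1 true).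
  rewrite swap_EF addr0 mul0r mul0r scale0r subr0; apply: (SD).
    exact: (Sgen1 false).
  by apply: SH0; apply: span_gen.
- exact: (Sgen1 false).
- exact: (Sgen1 true).
- apply: span_stable => // l; elim: l => [|[] l IH] /=.
  + by have [-> _] := FH0 (-1) isT.
  + have h : E 1 (F (-1) (mon l v)) =
        F (-1) (E 1 (mon l v)) + H 0 (mon l v) - k%:R *: mon l v.
      by rewrite swap_EF subrr eqxx !mul1r.
    have -> : F (-1) (E 1 (mon l v)) =
        E 1 (F (-1) (mon l v)) + (- H 0 (mon l v) + k%:R *: mon l v) by rewrite h; lmod.
    apply: (SD); first exact: (Sgen1 true).
    apply: (SD); first by apply: (SN); apply: SH0; apply: span_gen.
    by apply: (SZ); apply: span_gen.
  + by rewrite (rel_FF mA); apply: (Sgen1 false).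
by rewrite pnatr_eq0.
Qed.

(** [sugawara N] is 4(k+2) times the Sugawara operator L_0, with its sum over
    positive modes cut at [N]. It is a finite sum of products of elements of the algebra, and it
    agrees with the full operator on vectors killed by all modes below [- N]. *)
Definition sugawara_term (m : int) (u : V) : V :=
  2 *: E m (F (- m) u) + 2 *: F m (E (- m) u) + H m (H (- m) u).
Definition casimir (u : V) : V := 4 *: F 0 (E 0 u) + 2 *: H 0 u + H 0 (H 0 u).
Definition sugawara (N : nat) (u : V) : V :=
  casimir u + 2 *: \sum_(0 <= m < N) sugawara_term m.+1%:Z u.

Lemma sugawara_term_linear m : linear (sugawara_term m).
Proof.
apply: lin_add; last exact: lin_comp.
by apply: lin_add; apply: lin_scale; apply: lin_comp.
Qed.
Lemma sugawara_linear N : linear (sugawara N).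
Proof.
apply: lin_add.
  apply: lin_add; last exact: lin_comp.
  apply: lin_add; apply: lin_scale => //; exact: lin_comp.
apply: lin_scale.
have lS := @lin_bigsum K V V nat (index_iota 0 N) (fun m u => sugawara_term m.+1%:Z u)
  (fun m => sugawara_term_linear _).
exact: lS.
Qed.

Lemma sugawara_term_F0 (m : int) u : m != 0 -> sugawara_term m (F 0 u) = F 0 (sugawara_term m u).
Proof.
move=> m0; have t1 : E m (F (- m) (F 0 u)) = F 0 (E m (F (- m) u)) + H m (F (- m) u).
  by rewrite (rel_FF mA (- m)) swap_EF addr0 (negPf m0) mulr0n mulr0 mul0r scale0r subr0.
have t2 : F m (E (- m) (F 0 u)) = F 0 (F m (E (- m) u)) + F m (H (- m) u).
  rewrite swap_EF addr0 oppr_eq0 (negPf m0) mulr0n mulr0 mul0r scale0r subr0.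
  by rewrite (linD (lF m)) (rel_FF mA m).
have t3 : H m (H (- m) (F 0 u)) =
    F 0 (H m (H (- m) u)) - 2 *: F m (H (- m) u) - 2 *: H m (F (- m) u).
  by rewrite swap_HF addr0 (linB (lH m)) (linZ (lH m)) swap_HF addr0.
rewrite /sugawara_term t1 t2 t3 !(linD (lF 0)) !(linZ (lF 0)); lmod.
Qed.

(** The boundary term at mode [m]: summed over the modes, the failure of
    [sugawara_term] to commute with e_1 telescopes to such terms, apart from the
    central term at [m = 1]. *)
Let tel (m : int) (u : V) : V := 2 *: H m (E (1 - m) u) - 2 *: E m (H (1 - m) u).

Lemma sugawara_term_E1 (m : int) u : 0 < m -> sugawara_term m (E 1 u) =
  E 1 (sugawara_term m u) + (tel m u - tel (m + 1) u) + (2 * (m == 1)%:R * k%:R) *: E 1 u.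
Proof.
move=> m0; have m1 : (m + 1 == 0) = false by lia.
have o1 : - m + 1 = 1 - m by rewrite addrC.
have o2 : 1 - (m + 1) = - m by lia.
have m1E : (1 - m == 0) = (m == 1) by rewrite subr_eq0 eq_sym.
have t1 : E m (F (- m) (E 1 u)) =
    E 1 (E m (F (- m) u)) - E m (H (1 - m) u) + ((m == 1)%:R * k%:R) *: E 1 u.
  have -> : F (- m) (E 1 u) = E 1 (F (- m) u) - (H (1 - m) u - ((m == 1)%:R * k%:R) *: u).
    have h : E 1 (F (- m) u) =
        F (- m) (E 1 u) + H (1 - m) u - ((1 - m == 0)%:R * k%:R) *: u.
      by rewrite swap_EF mul1r.
    by rewrite m1E in h; rewrite h; lmod.
  rewrite !(linB (lE m)) (linZ (lE m)) (rel_EE mA m); case: eqP => [->|_]; lmod.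
have t2 : F m (E (- m) (E 1 u)) = E 1 (F m (E (- m) u)) - H (m + 1) (E (- m) u).
  rewrite (rel_EE mA (- m)) (swap_EF 1 m) [1 + m]addrC m1 mulr0n mulr0 mul0r scale0r subr0.
  by rewrite addrK.
have t3 : H m (H (- m) (E 1 u)) = E 1 (H m (H (- m) u)) + 2 *: E (m + 1) (H (- m) u)
    + 2 *: H m (E (1 - m) u).
  by rewrite swap_HE o1 (linD (lH m)) (linZ (lH m)) swap_HE.
rewrite /sugawara_term /tel o2 t1 t2 t3 !(linD (lE 1)) !(linZ (lE 1)); lmod.
Qed.

Lemma sugawara_F0 N u : sugawara N (F 0 u) = F 0 (sugawara N u).
Proof.
rewrite /sugawara (linD (lF 0)) (linZ (lF 0)) (lin_sum (lF 0)); congr (_ + _ *: _); last first.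
  by apply: eq_bigr => m _; rewrite sugawara_term_F0.
have t1 : E 0 (F 0 u) = F 0 (E 0 u) + H 0 u.
  by rewrite swap_EF mul0r mul0r scale0r subr0.
have t2 w : H 0 (F 0 w) = F 0 (H 0 w) - 2 *: F 0 w by rewrite swap_HF.
rewrite /casimir t1 t2 (linB (lH 0)) (linZ (lH 0)) !t2 !(linD (lF 0)) !(linZ (lF 0)).
by lmod.
Qed.

(** The telescoped sum leaves the boundary terms at 1, which cancel against the
    commutator of the Casimir element of the zero modes, and those at [N + 2],
    which vanish on [u]. What remains is proportional to the level plus the dual
    Coxeter number 2. *)
Lemma sugawara_E1 N u : E (- N.+1%:Z) u = 0 -> H (- N.+1%:Z) u = 0 ->
  sugawara N.+1 (E 1 u) = E 1 (sugawara N.+1 u) + (4 * k.+2%:R) *: E 1 u.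
Proof.
move=> EN HN.
have sumE M : \sum_(0 <= m < M.+1) sugawara_term m.+1%:Z (E 1 u) =
    E 1 (\sum_(0 <= m < M.+1) sugawara_term m.+1%:Z u) +
    (tel 1 u - tel M.+2%:Z u) + (2 * k%:R) *: E 1 u.
  elim: M => [|M IH]; first by rewrite !big_nat1 sugawara_term_E1 // mulr1.
  have -> : \sum_(0 <= m < M.+2) sugawara_term m.+1%:Z u =
      \sum_(0 <= m < M.+1) sugawara_term m.+1%:Z u + sugawara_term M.+2%:Z u
    by rewrite big_nat_recr.
  rewrite big_nat_recr // IH /= sugawara_term_E1 //.
  rewrite [in RHS](linD (lE 1)) (_ : M.+2%:Z + 1 = M.+3%:Z); last by lia.
  rewrite (_ : (M.+2%:Z == 1) = false) // mulr0n; lmod.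
rewrite /sugawara sumE (linD (lE 1)) (linZ (lE 1)).
have -> : tel N.+2%:Z u = 0.
  rewrite /tel (_ : 1 - N.+2%:Z = - N.+1%:Z); last by lia.
  by rewrite EN HN (lin0 (lH _)) (lin0 (lE _)) !scaler0 subrr.
have e0 : casimir (E 1 u) = E 1 (casimir u) - 4 *: H 1 (E 0 u) + 4 *: E 1 (H 0 u) + 8 *: E 1 u.
  have t1 : F 0 (E 0 (E 1 u)) = E 1 (F 0 (E 0 u)) - H 1 (E 0 u).
    rewrite (rel_EE mA 0) (swap_EF 1 0) mulr0n mulr0 mul0r scale0r subr0.
    by rewrite addrK.
  have t2 w : H 0 (E 1 w) = E 1 (H 0 w) + 2 *: E 1 w by rewrite swap_HE.
  rewrite /casimir t1 t2 (linD (lH 0)) (linZ (lH 0)) !t2 !(linD (lE 1)) !(linZ (lE 1)).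
  by lmod.
have -> : tel 1 u = 2 *: H 1 (E 0 u) - 2 *: E 1 (H 0 u) by rewrite /tel subrr.
have -> : k.+2%:R = k%:R + 2 :> K by rewrite -addn2 natrD.
by rewrite e0; lmod.
Qed.
End HighestWeight.

(** * The principal grading *)
Section PrincipalGrading.
Variables (K : numFieldType) (V : lmodType K) (A : action V) (k i : nat).
Hypothesis mA : is_module A.
Hypothesis level : forall u, cent A u = k%:R *: u.
Local Notation E := (loop A (sl2_e K)).
Local Notation F := (loop A (sl2_f K)).
Local Notation H := (loop A (sl2_h K)).
Local Notation mon := (mon A).
Local Notation sugawara := (sugawara A).
Ltac lmod := lmod_with K V.

Let lE n : linear (E n) := loop_lin mA _ n.
Let lF n : linear (F n) := loop_lin mA _ n.
Let lH n : linear (H n) := loop_lin mA _ n.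

(** Each simple raising operator raises the mode by at most 1, so modes below
    minus the length of a monomial pass through it and reach [v]. *)
Lemma mon_smooth v l (n : int) : is_hw A i v -> (size l)%:Z < n ->
  [/\ E (- n) (mon l v) = 0, F (- n) (mon l v) = 0 & H (- n) (mon l v) = 0].
Proof.
move=> [E0 FH0 _]; elim: l n => [|b l IH] n /= ln.
  have [-> ->] := FH0 (- n) ltac:(lia).
  by rewrite E0 //; lia.
have l1 : (size l)%:Z < n - 1 by lia.
have l2 : (size l)%:Z < n by lia.
have [e1 f1 h1] := IH (n - 1) l1; have [e2 f2 h2] := IH n l2.
have n0 : (- n == 0) = false by lia.
have n1 : (1 - n == 0) = false by lia.
have nE : - n + 1 = - (n - 1) by lia.
have nE' : 1 - n = - (n - 1) by lia.
case: b => /=; split.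
- by rewrite (rel_EE mA) e2 (lin0 (lE 1)).
- have h : E 1 (F (- n) (mon l v)) = F (- n) (E 1 (mon l v)).
    by rewrite (swap_EF mA level) nE' h1 -nE' n1 mulr0n mulr0 mul0r scale0r subr0 addr0.
  by rewrite -h f2 (lin0 (lE 1)).
- by rewrite (swap_HE mA) h2 (lin0 (lE 1)) nE e1 scaler0 addr0.
- rewrite (swap_EF mA level) e2 (lin0 (lF 0)) addr0 h2 n0.
  by rewrite mulr0n mulr0 mul0r scale0r subr0 addr0.
- by rewrite (rel_FF mA) f2 (lin0 (lF 0)).
by rewrite (swap_HF mA) h2 (lin0 (lF 0)) addr0 f2 scaler0 subr0.
Qed.

(** The Sugawara operator grows by 4(k+2) with each e_1 and by 0 with each f_0,
    while h_0 grows by 2 and - 2; in this combination both generators add 2(k+2),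
    and the constants make it vanish at a highest weight vector. *)
Definition pdegree (N : nat) (u : V) : V :=
  sugawara N u - (i * (i + 2))%N%:R *: u - k.+2%:R *: (H 0 u - i%:R *: u).

Lemma pdegree_linear N : linear (pdegree N).
Proof.
apply: lin_sub.
  by apply: lin_sub; [exact: sugawara_linear|apply: lin_scale; apply: lin_id].
apply: lin_scale; apply: lin_sub => //; apply: lin_scale; apply: lin_id.
Qed.

Lemma pdegree_hw N v : is_hw A i v -> pdegree N v = 0.
Proof.
move=> [E0 FH0 h0].
have -> : pdegree N v = sugawara N v - (i * (i + 2))%N%:R *: v.
  by rewrite /pdegree h0 subrr scaler0 subr0.
rewrite /sugawara big1_seq ?scaler0 ?addr0; last first.
  move=> m _; have [f0 h1] := FH0 (- m.+1%:Z) isT.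
  by rewrite /sugawara_term f0 h1 E0 // (lin0 (lE _)) (lin0 (lF _)) (lin0 (lH _)) !scaler0 !addr0.
rewrite /casimir E0 // (lin0 (lF 0)) scaler0 add0r h0 (linZ (lH 0)) h0 natrM natrD.
by lmod.
Qed.

Lemma pdegree_mon N v l : is_hw A i v -> (size l <= N)%N ->
  pdegree N (mon l v) = (2 * k.+2 * size l)%N%:R *: mon l v.
Proof.
move=> hv; elim: l N => [|b l IH] N /=; first by rewrite muln0 scale0r pdegree_hw.
case: N => // N; rewrite ltnS => lN; have {}IH := IH N.+1 (leqW lN).
have lN' : (size l)%:Z < N.+1%:Z by lia.
have [e0 _ h0] := mon_smooth hv lN'.
have sE : (2 * k.+2 * (size l).+1)%N%:R = (2 * k.+2 * size l)%N%:R + 2 * k.+2%:R :> K.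
  by rewrite mulnS addnC natrD !natrM.
set u := mon l v in IH *; rewrite sE.
have -> : pdegree N.+1 (raising A b u) =
    raising A b (pdegree N.+1 u) + (2 * k.+2%:R) *: raising A b u.
  rewrite /pdegree; case: b => /=.
    rewrite (sugawara_E1 mA level) ?e0 ?h0 // (swap_HE mA) add0r.
    by rewrite !(linB (lE 1)) !(linZ (lE 1)) !(linB (lE 1)) !(linZ (lE 1)); lmod.
  rewrite (sugawara_F0 mA level) (swap_HF mA) add0r.
  by rewrite !(linB (lF 0)) !(linZ (lF 0)) !(linB (lF 0)) !(linZ (lF 0)); lmod.
by rewrite IH (linZ (raising_linear mA b)); lmod.
Qed.

Lemma submodule_subspace W : is_submodule A W -> subspace W.
Proof. by case. Qed.

Lemma pdegree_submodule N W : is_submodule A W -> forall u, W u -> W (pdegree N u).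
Proof.
case=> W0 WD WZ Wl _ u Wu.
have WB x y : W x -> W y -> W (x - y).
  by move=> hx hy; apply: (WD) => //; rewrite -scaleN1r; apply: WZ.
have Wsug : W (sugawara N u).
  apply: (WD).
    by apply: (WD); [apply: (WD); apply: (WZ)|]; do ?apply: (Wl).
  apply: (WZ); elim: N => [|N IH]; first by rewrite big_nil.
  rewrite big_nat_recr //=; apply: (WD) => //.
  by apply: (WD); [apply: (WD); apply: (WZ)|]; do ?apply: (Wl).
apply: (WB); first by apply: (WB) => //; apply: (WZ).
by apply: (WZ); apply: (WB); [apply: (Wl)|apply: (WZ)].
Qed.

(** Every submodule is graded by the length of monomials, at least as far as its
    component of degree 0 is concerned. *)
Lemma leading_component W v a (p : seq (K * seq bool)) :
  is_submodule A W -> is_hw A i v -> (forall N, pdegree N a = 0) ->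
  (forall m, m \in p -> m.2 != [::]) ->
  W (a + \sum_(m <- p) m.1 *: mon m.2 v) -> W a.
Proof.
move=> sW hv ga p0.
pose N := \max_(m <- p) size m.2.
apply: (@eigen_filter _ _ (pdegree N) W _ p
  (fun m => (2 * k.+2 * size m.2)%N%:R) (fun m => m.1 *: mon m.2 v)) => //.
- exact: pdegree_linear.
- exact: submodule_subspace.
- exact: pdegree_submodule.
move=> m mp; split.
  rewrite pnatr_eq0 !muln_eq0 /=; apply: contra (p0 m mp).
  by rewrite size_eq0.
rewrite (linZ (pdegree_linear N)) pdegree_mon ?scalerA ?[_ * m.1]mulrC //.
by rewrite /N (big_rem m) //= leq_maxl.
Qed.
End PrincipalGrading.

(** * Uniqueness of the irreducible highest weight module *)
Section MkLinear.
Variables (K : fieldType) (U V : lmodType K) (f : U -> V) (lf : linear f).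
(** The proof of linearity is a phantom argument, from which the structure of
    linear map is inferred. *)
Definition mk_linear : U -> V := let _ := lf in f.
HB.instance Definition _ := GRing.isLinear.Build K U V *:%R mk_linear lf.
End MkLinear.

Section ProductAction.
Variables (K : fieldType) (V W : lmodType K) (A : action V) (B : action W).

Definition prod_action : action (V * W)%type := Action
  (fun x n u => (loop A x n u.1, loop B x n u.2)) (fun u => (cent A u.1, cent B u.2)).

Lemma prod_module : is_module A -> is_module B -> is_module prod_action.
Proof.
move=> mA mB; split=> [x n||n u|x n u|x y m n u].
- by move=> a u v; congr pair; apply: loop_linear.
- by move=> a u v; congr pair; apply: cent_linear.
- by move=> a x y; congr pair; apply: loop_linear_sl2.
- by congr pair; apply: cent_central.
by congr pair; apply: loop_bracket.
Qed.
End ProductAction.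

Lemma preim_submodule (K : fieldType) (V W : lmodType K) (A : action V) (B : action W)
    (g : V -> W) (U : W -> Prop) : linear g ->
  (forall x n v, g (loop A x n v) = loop B x n (g v)) ->
  (forall v, g (cent A v) = cent B (g v)) ->
  is_submodule B U -> is_submodule A (fun v => U (g v)).
Proof.
move=> lg gl gc [U0 UD UZ Ul Uc]; split=> [|u v|a v|x n v|v].
- by rewrite (lin0 lg).
- by rewrite (linD lg); apply: UD.
- by rewrite (linZ lg); apply: UZ.
- by rewrite gl; apply: Ul.
by rewrite gc; apply: Uc.
Qed.

Section Uniqueness.
Variables (K : numFieldType) (k i : nat).

Lemma is_L_level (V : lmodType K) (A : action V) : is_L i k A ->
  forall u, cent A u = k%:R *: u.
Proof.
case=> mA _ [v [gen _ _ kv _]]; apply: (gen (fun u => cent A u = k%:R *: u)) => //.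
have lC := cent_linear mA.
split=> [|u w hu hw|a u hu|x n u hu|u hu].
- by rewrite (lin0 lC) scaler0.
- by rewrite (linD lC) hu hw scalerDr.
- by rewrite (linZ lC) hu !scalerA mulrC.
- by rewrite (cent_central mA) hu (linZ (loop_lin mA x n)).
by rewrite hu (linZ lC) hu.
Qed.

Lemma zero_submodule (V : lmodType K) (A : action V) : is_module A ->
  is_submodule A (fun u => u = 0).
Proof.
move=> mA; split=> [//|u v -> ->|a v ->|x n v ->|v ->].
- by rewrite addr0.
- by rewrite scaler0.
- by rewrite (lin0 (loop_lin mA x n)).
by rewrite (lin0 (cent_linear mA)).
Qed.

(** The submodule [U] of the direct sum generated by the pair of highest weight
    vectors is the graph of the isomorphism. By irreducibility it is one unless it
    contains [(0, w)]. *)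
Lemma L_unique (V W : lmodType K) (A : action V) (B : action W) :
  is_L i k A -> is_L i k B ->
  exists g : {linear V -> W},
    [/\ injective g, forall w, exists v, w = g v,
        forall x n v, g (loop A x n v) = loop B x n (g v)
      & forall v, g (cent A v) = cent B (g v)].
Proof.
move=> LA LB; have levA := is_L_level LA; have levB := is_L_level LB.
case: LA => mA [[x0 nzx0] irrA] [v [genA Ev FHv _ hv]].
case: LB => mB [[y0 nzy0] irrB] [w [genB Ew FHw _ hw]].
have v0 : v <> 0 by move=> v0; apply: nzx0; apply: (genA _ (zero_submodule mA)).
have w0 : w <> 0 by move=> w0; apply: nzy0; apply: (genB _ (zero_submodule mB)).
pose Z := (V * W)%type : lmodType K.
pose P := prod_action A B.
have mP : is_module P by apply: prod_module.
have levP (u : Z) : cent P u = k%:R *: u by rewrite /= levA levB.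
have hwP : is_hw P i ((v, w) : Z).
  split=> [n n0|n n0|] /=; first by rewrite Ev // Ew.
    by have [-> ->] := FHv n n0; have [-> ->] := FHw n n0.
  by rewrite hv hw.
have hw0 : is_hw P i ((0, w) : Z).
  have l0 x n := lin0 (loop_lin mA x n).
  split=> [n n0|n n0|] /=; first by rewrite l0 Ew.
    by have [-> ->] := FHw n n0; rewrite !l0.
  by rewrite l0 hw; congr pair; rewrite scaler0.
pose U : Z -> Prop := span_of (mon P ^~ ((v, w) : Z)).
have sU : is_submodule P U by apply: mon_span_submodule hwP.
have [U0 UD UZ Ul Uc] := sU.
have UB x y : U x -> U y -> U (x - y).
  by move=> hx hy; apply: (UD) => //; rewrite -scaleN1r; apply: UZ.
have Uvw : U (v, w) by apply: (span_gen (mon P ^~ ((v, w) : Z)) [::]).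
have nU : ~ U (0, w).
  move=> [p /esym pE].
  pose c := \sum_(m <- p | m.2 == [::]) m.1.
  pose q := [seq m <- p | m.2 != [::]].
  have eE : ((0, w) : Z) = c *: ((v, w) : Z) + \sum_(m <- q) m.1 *: mon P m.2 ((v, w) : Z).
    rewrite -pE (bigID (fun m => m.2 == [::])) /= big_filter; congr (_ + _).
    by rewrite scaler_suml; apply: eq_bigr => m /eqP ->.
  have pE' : c *: ((v, w) : Z) - (0, w) + \sum_(m <- q) m.1 *: mon P m.2 ((v, w) : Z) = 0.
    by rewrite eE opprD addrA subrr sub0r addNr.
  have h : c *: ((v, w) : Z) - (0, w) = 0.
    apply: (leading_component mP levP (zero_submodule mP) hwP _ _ pE').
      move=> N; have lg := pdegree_linear k i mP N.
      rewrite (linB lg) (linZ lg) !(pdegree_hw k mP) ?scaler0 ?subrr //.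
    by move=> m; rewrite mem_filter => /andP[].
  have := congr1 fst h; rewrite /= subr0 => cv0.
  have c0 : c = 0.
    apply: contrapT => /eqP c0; apply: v0.
    by rewrite -[v]scale1r -(mulVf c0) -scalerA cv0 scaler0.
  have := congr1 snd h; rewrite /= c0 scale0r sub0r => /eqP.
  by rewrite oppr_eq0 => /eqP.
pose j1 (x : V) : Z := (x, 0); pose j2 (y : W) : Z := (0, y).
have lj1 : linear j1 by move=> a x y; congr pair; rewrite /= scaler0 addr0.
have lj2 : linear j2 by move=> a x y; congr pair; rewrite /= scaler0 addr0.
have l0A x n := lin0 (loop_lin mA x n); have l0B x n := lin0 (loop_lin mB x n).
have c0A := lin0 (cent_linear mA); have c0B := lin0 (cent_linear mB).
have N1 x : U (j1 x) -> x = 0.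
  have sub : is_submodule A (fun x => U (j1 x)).
    by apply: preim_submodule sU => // [y n u|u]; rewrite /j1 /= ?l0B ?c0B.
  have [h|h] := irrA _ sub; first exact: h.
  by case: nU; have := UB _ _ Uvw (h v); rewrite (_ : _ - _ = (0, w)) //;
    congr pair; rewrite /= ?subrr ?subr0.
have N2 y : U (j2 y) -> y = 0.
  have sub : is_submodule B (fun y => U (j2 y)).
    by apply: preim_submodule sU => // [z n u|u]; rewrite /j2 /= ?l0A ?c0A.
  by have [h|h] := irrB _ sub; [exact: h|case: nU; apply: h].
have tot x : exists y, U (x, y).
  apply: (genA (fun x => exists y, U (x, y))); last by exists w.
  split=> [|a b [a' ha] [b' hb]|a b [b' hb]|y n b [b' hb]|b [b' hb]].
  - by exists 0.
  - by exists (a' + b'); apply: (UD _ _ ha hb).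
  - by exists (a *: b'); apply: (UZ a _ hb).
  - by exists (loop B y n b'); apply: (Ul y n _ hb).
  by exists (cent B b'); apply: (Uc _ hb).
have sur y : exists x, U (x, y).
  apply: (genB (fun y => exists x, U (x, y))); last by exists v.
  split=> [|a b [a' ha] [b' hb]|a b [b' hb]|z n b [b' hb]|b [b' hb]].
  - by exists 0.
  - by exists (a' + b'); apply: (UD _ _ ha hb).
  - by exists (a *: b'); apply: (UZ a _ hb).
  - by exists (loop A z n b'); apply: (Ul z n _ hb).
  by exists (cent A b'); apply: (Uc _ hb).
have fun2 x y y' : U (x, y) -> U (x, y') -> y = y'.
  move=> h1 h2; apply/eqP; rewrite -subr_eq0; apply/eqP/N2.
  by have := UB _ _ h1 h2; rewrite (_ : _ - _ = j2 (y - y')) //; congr pair; rewrite /= subrr.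
have fun1 x x' y : U (x, y) -> U (x', y) -> x = x'.
  move=> h1 h2; apply/eqP; rewrite -subr_eq0; apply/eqP/N1.
  by have := UB _ _ h1 h2; rewrite (_ : _ - _ = j1 (x - x')) //; congr pair; rewrite /= subrr.
have [g gU] := choice tot.
have lg : linear g.
  by move=> a x y; apply: fun2 (gU _) _; apply: (UD _ _ (UZ a _ (gU x)) (gU y)).
exists (mk_linear lg); rewrite /mk_linear; split=> [x x' e|y|x n u|u].
- by apply: fun1 (gU x) _; rewrite (e : g x = g x').
- by have [x xy] := sur y; exists x; apply: fun2 xy (gU x).
- by apply: fun2 (gU _) _; apply: (Ul x n _ (gU u)).
by apply: fun2 (gU _) _; apply: (Uc _ (gU u)).
Qed.
End Uniqueness.

(** * Free modules and semi-infinite monomials *)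
Section LinExt.
Variables (K : fieldType) (S : choiceType) (V : lmodType K).
Implicit Types (f g : S -> V) (v : {malg K[S]}).

Lemma lin_extEw f v (d : {fset S}) : (msupp v `<=` d)%fset ->
  lin_ext f v = \sum_(s <- d) v@_s *: f s.
Proof.
move=> vd; rewrite /lin_ext; apply: big_fset_incl => // s _ /mcoeff_outdom ->.
by rewrite scale0r.
Qed.

Lemma lin_ext_linear f : linear (lin_ext f).
Proof.
move=> a u v; pose d := (msupp u `|` msupp v)%fset.
have su : (msupp u `<=` d)%fset by apply: fsubsetUl.
have sv : (msupp v `<=` d)%fset by apply: fsubsetUr.
have suv : (msupp (a *: u + v) `<=` d)%fset.
  apply: fsubset_trans (msuppD_le _ _) _; rewrite fsubUset sv andbT.
  exact: fsubset_trans (msuppZ_le _ _) su.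
rewrite !(lin_extEw _ su, lin_extEw _ sv, lin_extEw _ suv) scaler_sumr -big_split.
by apply: eq_bigr => s _; rewrite mcoeffD mcoeffZ scalerDl scalerA.
Qed.

Lemma lin_extU f s : lin_ext f << s >> = f s.
Proof.
rewrite (@lin_extEw _ _ [fset s]%fset) ?msuppU_le //.
by rewrite big_seq_fset1 mcoeffUU scale1r.
Qed.

Lemma malg_sum v : v = \sum_(s <- msupp v) v@_s *: << s >>.
Proof.
rewrite {1}[v]monalgE; apply: eq_bigr => s _; apply/malgP => t.
by rewrite mcoeffZ !mcoeffU; case: eqP; rewrite ?mulr1 ?mulr0.
Qed.

Lemma malg_ind (P : {malg K[S]} -> Prop) :
  P 0 -> (forall a u v, P u -> P v -> P (a *: u + v)) ->
  (forall s, P << s >>) -> forall v, P v.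
Proof.
move=> P0 PD PU v; rewrite [v]malg_sum; elim: (enum_fset _) => [|s r IH].
  by rewrite big_nil.
by rewrite big_cons; apply: PD.
Qed.

Lemma lin_eq (f g : {malg K[S]} -> V) : linear f -> linear g ->
  (forall s, f << s >> = g << s >>) -> forall v, f v = g v.
Proof.
move=> lf lg fg; elim/malg_ind => [|a u v Hu Hv|//].
  by rewrite (lin0 lf) (lin0 lg).
by rewrite lf lg Hu Hv.
Qed.
End LinExt.

Section States.
Implicit Types (S T : state) (m n : int).

Lemma occ_toggle S n m : occupied (toggle S n) m = occupied S m (+) (m == n).
Proof.
rewrite /occupied /toggle; case: ifP => nS; rewrite !inE; case: eqP => [->|_] /=;
  rewrite ?nS ?addbF //=; first by rewrite addbT negbK.
by rewrite addbT.
Qed.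

Lemma stateP S T : (forall n, occupied S n = occupied T n) -> S = T.
Proof.
move=> ST; apply/fsetP => n; have := ST n; rewrite /occupied.
by move/(can_inj (addbK _)).
Qed.

Lemma toggleK n : involutive (fun S => toggle S n).
Proof. by move=> S; apply: stateP => m; rewrite !occ_toggle addbK. Qed.

Lemma toggleC S m n : toggle (toggle S n) m = toggle (toggle S m) n.
Proof. by apply: stateP => l; rewrite !occ_toggle addbAC. Qed.

Lemma toggle_vac m : toggle (vac_state m) (m + 1) = vac_state (m + 1).
Proof. by apply: stateP => n; rewrite occ_toggle !occupied_vac; lia. Qed.

Variable K : fieldType.

(** The Jordan-Wigner sign of the factors to be crossed. *)
Definition jw_sign S n : K := (-1) ^+ crossings S n.

Lemma jw_sign_toggle S m n : jw_sign (toggle S m) n = (if n < m then -1 else 1) * jw_sign S n.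
Proof.
rewrite /jw_sign /crossings !exprD mulrA; congr (_ * _).
have nn : (-1) * (-1) = 1 :> K by rewrite mulrNN mulr1.
rewrite /toggle; case: ifP => mS.
  have /permP-> : perm_eq S (m :: (S `\ m)%fset).
    apply: uniq_perm; rewrite /= ?fset_uniq // ?andbT.
      by rewrite !inE eqxx.
    by move=> x; rewrite !inE; case: eqP => [->|].
  by rewrite /= exprD mulrA; case: ifP; rewrite ?expr1 ?expr0 ?nn ?mul1r.
have /permP-> : perm_eq (m |` S)%fset (m :: S).
  apply: uniq_perm; rewrite /= ?fset_uniq // ?andbT ?mS //.
  by move=> x; rewrite !inE.
by rewrite /= exprD; case: ifP; rewrite ?expr1 ?expr0 ?nn ?mul1r.
Qed.

Lemma jw_sign_self S n : jw_sign (toggle S n) n = jw_sign S n.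
Proof. by rewrite jw_sign_toggle ltxx mul1r. Qed.

Lemma jw_sign2 S n : jw_sign S n * jw_sign S n = 1.
Proof. by rewrite /jw_sign -expr2 sqrr_sign. Qed.

Lemma jw_sign_neq0 S n : jw_sign S n != 0.
Proof. by rewrite signr_eq0. Qed.

Lemma toggle_ind (P : state -> Prop) S0 :
  P S0 -> (forall S n, P S -> P (toggle S n)) -> forall S, P S.
Proof.
move=> P0 PT.
have toggleP S n : P (toggle S n) <-> P S.
  by split=> [/(PT _ n)|/PT//]; rewrite toggleK.
have allP S : P S <-> P fset0.
  elim/fset1U_rect: S => [//|n S nS <-].
  by rewrite -(toggleP S n) /toggle (negPf nS).
by move=> S; apply/allP/(allP S0).
Qed.
End States.

(** The locked copies of [create] and [annihilate], and likewise those of the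
    currents and of the tensor operators below, keep unification from unfolding
    two different operators into the sums that define them. *)
HB.lock Definition creation (K : fieldType) (n : int) : F K -> F K := create n.
HB.lock Definition annihilation (K : fieldType) (n : int) : F K -> F K := annihilate n.

Section CAR.
Variable K : fieldType.
Local Notation F := (F K).
Local Notation jw_sign := (@jw_sign K).
Local Notation creation := (@creation K).
Local Notation annihilation := (@annihilation K).

Lemma creation_linear n : linear (creation n).
Proof. rewrite unlock; exact: lin_ext_linear. Qed.
Lemma annihilation_linear n : linear (annihilation n).
Proof. rewrite unlock; exact: lin_ext_linear. Qed.
Hint Resolve creation_linear annihilation_linear : core.

Lemma creationU n S : creation n << S >> =
  if occupied S n then 0 else jw_sign S n *: << toggle S n >>.
Proof. by rewrite unlock /create lin_extU. Qed.
Lemma annihilationU n S : annihilation n << S >> =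
  if occupied S n then jw_sign S n *: << toggle S n >> else 0.
Proof. by rewrite unlock /annihilate lin_extU. Qed.

Lemma creation_anticomm n m u : creation n (creation m u) = - creation m (creation n u).
Proof.
move: u; apply: lin_eq => [||S].
- by apply: lin_comp.
- by apply: lin_opp; apply: lin_comp.
have lc l := linZ (creation_linear l); have l0 l := lin0 (creation_linear l).
rewrite !creationU.
have [->|nm] := eqVneq n m.
  by case: ifP => h; rewrite ?l0 ?oppr0 // lc creationU occ_toggle h eqxx /= scaler0 oppr0.
case: ifP => hm; case: ifP => hn; rewrite ?l0 ?oppr0 // lc creationU occ_toggle
  ?hm ?hn ?(negPf nm) ?[m == n]eq_sym ?(negPf nm) ?scaler0 ?oppr0 //=.
rewrite lc creationU occ_toggle hm eq_sym (negPf nm) /= !scalerA -scaleNr toggleC.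
congr (_ *: _); rewrite !jw_sign_toggle.
by case: (ltgtP n m) nm => //= *; rewrite ?mulNr ?mul1r ?mulrN ?opprK // mulrC.
Qed.

Lemma annihilation_anticomm n m u :
  annihilation n (annihilation m u) = - annihilation m (annihilation n u).
Proof.
move: u; apply: lin_eq => [||S].
- by apply: lin_comp.
- by apply: lin_opp; apply: lin_comp.
have lc l := linZ (annihilation_linear l); have l0 l := lin0 (annihilation_linear l).
rewrite !annihilationU.
have [->|nm] := eqVneq n m.
  by case: ifP => h; rewrite ?l0 ?oppr0 // lc annihilationU occ_toggle h eqxx /= scaler0 oppr0.
case: ifP => hm; case: ifP => hn; rewrite ?l0 ?oppr0 // lc annihilationU occ_toggle
  ?hm ?hn ?(negPf nm) ?[m == n]eq_sym ?(negPf nm) ?scaler0 ?oppr0 //=.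
rewrite lc annihilationU occ_toggle hm eq_sym (negPf nm) /= !scalerA -scaleNr toggleC.
congr (_ *: _); rewrite !jw_sign_toggle.
by case: (ltgtP n m) nm => //= *; rewrite ?mulNr ?mul1r ?mulrN ?opprK // mulrC.
Qed.

Lemma annihilation_creation n m u :
  annihilation n (creation m u) = (n == m)%:R *: u - creation m (annihilation n u).
Proof.
move: u; apply: lin_eq => [||S].
- by apply: lin_comp.
- apply: lin_sub; last exact: lin_comp.
  by apply: lin_scale; apply: lin_id.
have ac l := linZ (annihilation_linear l); have a0 l := lin0 (annihilation_linear l).
have lc l := linZ (creation_linear l); have l0 l := lin0 (creation_linear l).
rewrite creationU annihilationU.
have [->|nm] := eqVneq n m.
  case: ifP => h; rewrite ?a0 ?ac ?l0 ?lc ?annihilationU ?creationU occ_toggle h eqxx /=.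
    by rewrite toggleK jw_sign_self scalerA jw_sign2 !scale1r subrr.
  by rewrite toggleK jw_sign_self scalerA jw_sign2 !scale1r subr0.
rewrite scale0r sub0r.
case: ifP => hm; case: ifP => hn; rewrite ?a0 ?ac ?l0 ?lc ?oppr0 // ?annihilationU ?creationU
  !occ_toggle ?hm ?hn ?(negPf nm) ?[m == n]eq_sym ?(negPf nm) ?scaler0 ?oppr0 //=.
rewrite !scalerA -scaleNr toggleC.
congr (_ *: _); rewrite !jw_sign_toggle.
by case: (ltgtP n m) nm => //= *; rewrite ?mulNr ?mul1r ?mulrN ?opprK // mulrC.
Qed.

Definition vac m : F := << vac_state m >>.

Lemma creation_vac0 n m : n <= m -> creation n (vac m) = 0.
Proof. by move=> nm; rewrite creationU occupied_vac nm. Qed.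
Lemma annihilation_vac0 n m : m < n -> annihilation n (vac m) = 0.
Proof. by move=> nm; rewrite annihilationU occupied_vac leNgt nm. Qed.

Lemma vac_step m : exists2 c : K, c != 0 &
  creation (m + 1) (vac m) = c *: vac (m + 1) /\ annihilation (m + 1) (vac (m + 1)) = c *: vac m.
Proof.
exists (jw_sign (vac_state m) (m + 1)); first exact: jw_sign_neq0.
have n1 : (m + 1 <= m) = false by lia.
rewrite creationU annihilationU !occupied_vac lexx n1 /vac -toggle_vac toggleK jw_sign_self.
by split.
Qed.

(** F is generated from any v(m) by the fermions, so an operator commuting with
    all of them is determined by its value there. *)
Lemma eq_scalar_of_commuting (X : F -> F) m c : linear X ->
  (forall n u, X (creation n u) = creation n (X u)) ->
  (forall n u, X (annihilation n u) = annihilation n (X u)) ->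
  X (vac m) = c *: vac m -> forall u, X u = c *: u.
Proof.
move=> lX Xc Xa Xm; apply: lin_eq => //; first by apply: lin_scale.
apply: (toggle_ind Xm) => S n XS.
have tS : << toggle S n >> =
    jw_sign S n *: (if occupied S n then annihilation n << S >> else creation n << S >>) :> F.
  by rewrite creationU annihilationU; case: ifP => h; rewrite ?h scalerA jw_sign2 scale1r.
rewrite tS (linZ lX); case: ifP => _.
  by rewrite Xa XS (linZ (@annihilation_linear n)) !scalerA mulrC.
by rewrite Xc XS (linZ (@creation_linear n)) !scalerA mulrC.
Qed.
End CAR.

(** * The Hermitian form with orthonormal monomials *)
Section Hermitian.
Variables (K : numClosedFieldType) (S : choiceType).
Local Notation V := ({malg K[S]} : lmodType K).
Implicit Types u v w : V.

Definition hform u v : K := \sum_(s <- msupp u) u@_s * (v@_s)^*.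

Lemma hformEw u v (d : {fset S}) : (msupp u `<=` d)%fset ->
  hform u v = \sum_(s <- d) u@_s * (v@_s)^*.
Proof.
move=> ud; rewrite /hform; apply: big_fset_incl => // s _ /mcoeff_outdom ->.
by rewrite mul0r.
Qed.

Lemma hform_lin v : linear (fun u => hform u v : K^o).
Proof.
move=> a u w; pose d := (msupp u `|` msupp w)%fset.
have su : (msupp u `<=` d)%fset by apply: fsubsetUl.
have sw : (msupp w `<=` d)%fset by apply: fsubsetUr.
have suw : (msupp (a *: u + w) `<=` d)%fset.
  apply: fsubset_trans (msuppD_le _ _) _; rewrite fsubUset sw andbT.
  exact: fsubset_trans (msuppZ_le _ _) su.
rewrite (hformEw _ su) (hformEw _ sw) (hformEw _ suw) scaler_sumr -big_split.
apply: eq_bigr => s _; rewrite mcoeffD mcoeffZ mulrDl -mulrA //.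
Qed.

Lemma hformC u v : hform v u = (hform u v)^*.
Proof.
pose d := (msupp u `|` msupp v)%fset.
have su : (msupp u `<=` d)%fset by apply: fsubsetUl.
have sv : (msupp v `<=` d)%fset by apply: fsubsetUr.
rewrite (hformEw _ su) (hformEw _ sv) rmorph_sum; apply: eq_bigr => s _.
by rewrite rmorphM /= conjCK mulrC.
Qed.

Lemma hform_eq0 u : hform u u = 0 -> u = 0.
Proof.
rewrite /hform => /eqP; rewrite psumr_eq0; last by move=> s _; exact: mul_conjC_ge0.
move=> /allP h; apply/malgP => s; rewrite mcoeff0.
have [su|/mcoeff_outdom//] := boolP (s \in msupp u).
by have := h s su; rewrite /= mul_conjC_eq0 => /eqP.
Qed.

Lemma hformUU s t : hform << s >> << t >> = (s == t)%:R.
Proof.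
rewrite (@hformEw _ _ [fset s]%fset) ?msuppU_le // big_seq_fset1 !mcoeffU eqxx mul1r.
by rewrite eq_sym; case: eqP => _; rewrite ?rmorph1 ?rmorph0.
Qed.

Definition adjoint (X Y : V -> V) := forall u v, hform (X u) v = hform u (Y v).

Lemma adjoint_sym X Y : adjoint X Y -> adjoint Y X.
Proof. by move=> XY u v; rewrite hformC -XY -hformC. Qed.

Lemma adjoint_comp X X' Y Y' : adjoint X X' -> adjoint Y Y' ->
  adjoint (fun u => X (Y u)) (fun u => Y' (X' u)).
Proof. by move=> hX hY u v; rewrite hX hY. Qed.

Lemma hformDl u v w : hform (u + v) w = hform u w + hform v w.
Proof. exact: linD (@hform_lin w) _ _. Qed.
Lemma hformZl a u w : hform (a *: u) w = a * hform u w.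
Proof. exact: linZ (@hform_lin w) _ _. Qed.
Lemma hformDr u v w : hform w (u + v) = hform w u + hform w v.
Proof. by rewrite hformC hformDl rmorphD /= -!hformC. Qed.
Lemma hformZr a u w : hform w (a *: u) = a^* * hform w u.
Proof. by rewrite hformC hformZl rmorphM /= -!hformC. Qed.
Lemma hform0l w : hform 0 w = 0.
Proof. exact: lin0 (@hform_lin w). Qed.
Lemma hform0r w : hform w 0 = 0.
Proof. by rewrite hformC hform0l rmorph0. Qed.

Lemma adjoint_add X X' Y Y' : adjoint X X' -> adjoint Y Y' ->
  adjoint (fun u => X u + Y u) (fun u => X' u + Y' u).
Proof. by move=> hX hY u v; rewrite hformDl hX hY hformDr. Qed.
Lemma adjoint_opp X X' : adjoint X X' ->
  adjoint (fun u => - X u) (fun u => - X' u).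
Proof.
by move=> hX u v; rewrite -!scaleN1r hformZl hX hformZr rmorphN rmorph1.
Qed.
Lemma adjoint_scale X X' c : adjoint X X' ->
  adjoint (fun u => c *: X u) (fun u => c^* *: X' u).
Proof. by move=> hX u v; rewrite hformZl hX hformZr conjCK. Qed.
Lemma adjoint_sum I (r : seq I) (X X' : I -> V -> V) :
  (forall i, adjoint (X i) (X' i)) ->
  adjoint (fun u => \sum_(i <- r) X i u) (fun u => \sum_(i <- r) X' i u).
Proof.
move=> hX u v; elim: r => [|i r IH]; rewrite ?big_nil ?big_cons.
  by rewrite hform0l hform0r.
by rewrite hformDl hformDr hX IH.
Qed.

Lemma adjoint_basis X Y : linear X -> linear Y ->
  (forall s t, hform (X << s >>) << t >> = hform << s >> (Y << t >>)) -> adjoint X Y.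
Proof.
move=> lX lY h; elim/malg_ind => [v|a u w hu hw v|s].
- by rewrite (lin0 lX) !hform0l.
- by rewrite lX !hformDl !hformZl hu hw.
elim/malg_ind => [|a u w hu hw|t].
- by rewrite (lin0 lY) !hform0r.
- by rewrite lY !hformDr !hformZr hu hw.
exact: h.
Qed.

Lemma adjoint_eq X X' Y Y' : adjoint X X' -> adjoint Y Y' ->
  (forall u, X' u = Y' u) -> forall u, X u = Y u.
Proof.
move=> hX hY e u; apply/eqP; rewrite -subr_eq0; apply/eqP/hform_eq0.
set w := _ - _.
by rewrite {1}/w -scaleN1r hformDl hformZl hX hY e mulN1r subrr.
Qed.
End Hermitian.

Lemma creation_adjoint (K : numClosedFieldType) n :
  adjoint (@creation K n) (@annihilation K n).
Proof.
apply: adjoint_basis => [||S T]; [exact: creation_linear|exact: annihilation_linear|].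
rewrite creationU annihilationU.
have e : (toggle S n == T) = (S == toggle T n).
  by apply/eqP/eqP => [<-|->]; rewrite toggleK.
have [eT|neT] := eqVneq S (toggle T n).
  rewrite eT occ_toggle eqxx addbT toggleK jw_sign_self; case: (occupied T n) => /=.
    by rewrite hformZl hformZr !hformUU !eqxx rmorph_sign.
  by rewrite hform0l hform0r.
case: ifP; case: ifP; rewrite ?hform0l ?hform0r // ?hformZl ?hformZr !hformUU
  ?e ?(negPf neT) ?mulr0 //.
Qed.

(** * The currents e(z) and f(z) *)
Section Windows.
Variable V : nmodType.

Definition window (N : nat) : seq int := [seq j%:Z - N%:Z | j <- iota 0 (2 * N).+1].

Lemma window_uniq N : uniq (window N).
Proof. by rewrite map_inj_uniq ?iota_uniq // => a b; lia. Qed.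

Lemma mem_window N (a : int) : (a \in window N) = (`|a| <= N)%N.
Proof.
apply/mapP/idP => [[j]|aN]; first by rewrite mem_iota => h ->; lia.
exists (absz (a + N%:Z)%R); last lia.
by rewrite mem_iota; lia.
Qed.

Lemma fsum_window (P : int -> V) N (r : seq int) :
  (forall a : int, (N < `|a|)%N -> P a = 0) ->
  uniq r -> {subset window N <= r} ->
  \sum_(a \in [set: int]%classic) P a = \sum_(a <- r) P a.
Proof.
move=> P0 ur sr; rewrite (fsbigE r) //.
- by rewrite big_mkcond /=; apply: eq_bigr => a _; rewrite in_setT.
- move=> a _ ar; apply: P0; rewrite ltnNge -mem_window.
  by apply: contra ar; apply: sr.
Qed.
End Windows.

Lemma sum_delta (K : fieldType) (V : lmodType K) (r : seq int) (c : int) (X : int -> V) :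
  uniq r -> c \in r -> \sum_(a <- r) (a == c)%:R *: X a = X c.
Proof.
move=> ur cr; rewrite (bigD1_seq c) //= eqxx scale1r big1 ?addr0 // => a /negPf->.
by rewrite scale0r.
Qed.

HB.lock Definition cur_e (K : fieldType) (p : int) : F K -> F K := eF p.
HB.lock Definition cur_f (K : fieldType) (p : int) : F K -> F K := fF p.

Section Currents.
Variable K : numClosedFieldType.
Local Notation F := (F K).
Local Notation cr := (@creation K).
Local Notation an := (@annihilation K).
Local Notation e := (@cur_e K).
Local Notation f := (@cur_f K).
Local Notation vac := (@vac K).
Ltac lmod := lmod_with K constr:(Defs.F K : lmodType K).

Let lcr n : linear (cr n) := @creation_linear K n.
Let lan n : linear (an n) := @annihilation_linear K n.

(** Far enough on the negative side every variable is present in each of the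
    finitely many monomials of [u], and far enough on the positive side absent;
    this makes the sums of the currents finite on [u]. *)
Lemma bounded_support (u : F) :
  exists N : nat, forall n, (N < `|n|)%N -> if n < 0 then cr n u = 0 else an n u = 0.
Proof.
elim/malg_ind: u => [|a u v [N1 h1] [N2 h2]|S].
- by exists 0%N => n _; rewrite (lin0 (lcr n)) (lin0 (lan n)); case: ifP.
- exists (maxn N1 N2) => n; rewrite gtn_max => /andP[/h1 hu /h2 hv].
  by move: hu hv; case: ifP => _ hu hv; rewrite ?lcr ?lan hu hv scaler0 addr0.
exists (\max_(n <- S) `|n|)%N => n nS.
have {}nS : n \notin S.
  apply: contraL nS => nS; rewrite -leqNgt.
  by rewrite (big_rem n) //= leq_maxl.
by rewrite creationU annihilationU /occupied (negPf nS) /=; case: (n < 0).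
Qed.

(** All uniform statements about e_p and f_p come from computing with one finite
    set of indices, large enough for all the vectors that occur. *)
Lemma eE p u : exists N, forall r, uniq r -> {subset window N <= r} ->
  e p u = \sum_(a <- r) cr (2 * a) (cr (2 * (p - a) + 1) u).
Proof.
have [N h] := bounded_support u.
exists (N + `|p| + 1)%N => r ur sr; rewrite [cur_e]unlock /eF /psi /phi.
have -> : @create K = cr by rewrite unlock.
apply: fsum_window ur sr => a aN.
have [a0|a0] := ltP a 0.
  rewrite creation_anticomm; have := h (2 * a); rewrite ifT; last lia.
  by move=> ->; [rewrite (lin0 (lcr _)) oppr0 | lia].
have := h (2 * (p - a) + 1); rewrite ifT; last lia.
by move=> ->; [rewrite (lin0 (lcr _)) | lia].
Qed.

Lemma fE p u : exists N, forall r, uniq r -> {subset window N <= r} ->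
  f p u = \sum_(a <- r) an (2 * - a + 1) (an (2 * - (p - a)) u).
Proof.
have [N h] := bounded_support u.
exists (N + `|p| + 1)%N => r ur sr; rewrite [cur_f]unlock /fF /phi_star /psi_star.
have -> : @annihilate K = an by rewrite unlock.
apply: fsum_window ur sr => a aN.
have [a0|a0] := ltP a 0.
  rewrite annihilation_anticomm; have := h (2 * - a + 1); rewrite ifF; last lia.
  by move=> ->; [rewrite (lin0 (lan _)) oppr0 | lia].
have := h (2 * - (p - a)); rewrite ifF; last lia.
by move=> ->; [rewrite (lin0 (lan _)) | lia].
Qed.

Lemma window_sub M N : (M <= N)%N -> {subset window M <= window N}.
Proof. by move=> MN a; rewrite !mem_window => /leq_trans->. Qed.

Lemma e_linear p : linear (e p).
Proof.
move=> a u v.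
have [N1 h1] := eE p u; have [N2 h2] := eE p v; have [N3 h3] := eE p (a *: u + v).
have sub N : (N <= N1 + N2 + N3)%N -> {subset window N <= window (N1 + N2 + N3)}.
  exact: window_sub.
rewrite (h1 (window (N1 + N2 + N3))) ?(h2 (window (N1 + N2 + N3)))
  ?(h3 (window (N1 + N2 + N3))) ?window_uniq //; try by apply: sub; lia.
rewrite scaler_sumr -big_split; apply: eq_bigr => c _.
by rewrite !lcr.
Qed.

Lemma create2_create n a b u : cr a (cr b (cr n u)) = cr n (cr a (cr b u)).
Proof. by rewrite (creation_anticomm b) (linN (lcr a)) creation_anticomm opprK. Qed.

Lemma e_create p n u : e p (cr n u) = cr n (e p u).
Proof.
have [N1 h1] := eE p u; have [N2 h2] := eE p (cr n u).
have sub N : (N <= N1 + N2)%N -> {subset window N <= window (N1 + N2)}.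
  exact: window_sub.
rewrite (h1 (window (N1 + N2))) ?(h2 (window (N1 + N2))) ?window_uniq //;
  try by apply: sub; lia.
rewrite (lin_sum (lcr n)); apply: eq_bigr => a _.
exact: create2_create.
Qed.

(** The sign with which a fermion contributes to commutators with e_p and f_p: it
    tells psi, whose numbers are even, from phi. The partner in e_p of the variable
    number [n] has number 2p + 1 - n. *)
Definition parity_sign (n : int) : K := (-1) ^+ odd `|n|%N.

Lemma int_parity (n : int) : exists c, n = 2 * c \/ n = 2 * c + 1.
Proof. by exists (n %/ 2)%Z; lia. Qed.
Lemma parity_sign_even c : parity_sign (2 * c) = 1.
Proof. by rewrite /parity_sign (_ : odd _ = false) //; lia. Qed.
Lemma parity_sign_odd c : parity_sign (2 * c + 1) = -1.
Proof. by rewrite /parity_sign (_ : odd _ = true) //; lia. Qed.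
Lemma parity_sign_reflect c n : parity_sign (2 * c + 1 - n) = - parity_sign n.
Proof.
rewrite /parity_sign (_ : odd _ = ~~ odd `|n|%N); last by lia.
by rewrite signrN.
Qed.
Lemma parity_signM n : parity_sign n * parity_sign n = 1.
Proof. by rewrite -expr2 sqrr_sign. Qed.

Lemma ann_create2 n a b u : an n (cr a (cr b u)) =
  (n == a)%:R *: cr b u - (n == b)%:R *: cr a u + cr a (cr b (an n u)).
Proof.
rewrite annihilation_creation annihilation_creation (linB (lcr _)) (linZ (lcr _)).
by lmod.
Qed.

Lemma e_ann p n u : e p (an n u) = an n (e p u) - parity_sign n *: cr (2 * p + 1 - n) u.
Proof.
have [N1 h1] := eE p u; have [N2 h2] := eE p (an n u).
pose r := window (N1 + N2 + `|n| + `|p| + 1)%N.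
have ur : uniq r by apply: window_uniq.
rewrite (h1 r) ?(h2 r) // /r; try by apply: window_sub; lia.
rewrite (lin_sum (lan n)) -/r.
under [in RHS]eq_bigr => a _ do rewrite ann_create2.
rewrite big_split /= sumrB addrC; set S := \sum_(a <- r) cr _ _.
rewrite -[LHS]addr0 -addrA; congr (_ + _); apply/esym/eqP; rewrite subr_eq0; apply/eqP.
have [c [en|en]] := int_parity n; rewrite [in RHS]en ?parity_sign_even ?parity_sign_odd.
- rewrite (eq_bigr (fun a => (a == c)%:R *: cr (2 * (p - a) + 1) u)); last first.
    by move=> a _; rewrite (_ : (n == _) = (a == c)) //; lia.
  rewrite [X in _ - X]big1 ?subr0; last first.
    by move=> a _; rewrite (_ : (n == _) = false) ?scale0r //; lia.
  rewrite sum_delta // ?scale1r; last by rewrite mem_window; lia.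
  by congr (cr _ _); lia.
- rewrite big1 ?sub0r; last first.
    by move=> a _; rewrite (_ : (n == _) = false) ?scale0r //; lia.
  rewrite (eq_bigr (fun a => (a == p - c)%:R *: cr (2 * a) u)); last first.
    by move=> a _; rewrite (_ : (n == _) = (a == p - c)) //; lia.
  rewrite sum_delta //; last by rewrite mem_window; lia.
  by rewrite scaleN1r; congr (- cr _ _); lia.
Qed.

Lemma e_f_adjoint p : adjoint (e p) (f (- p)).
Proof.
move=> u v; have [N1 h1] := eE p u; have [N2 h2] := fE (- p) v.
pose r := window (N1 + N2 + `|p|)%N.
rewrite (h1 r) ?window_uniq //; last by apply: window_sub; lia.
rewrite (h2 [seq a - p | a <- r]); first last.
- move=> a; rewrite mem_window => aN; apply/mapP; exists (a + p); last lia.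
  by rewrite mem_window; lia.
- by rewrite map_inj_uniq ?window_uniq // => a b; lia.
rewrite [in RHS]big_map; apply: (@adjoint_sum _ _ _ r
  (fun a w => cr (2 * a) (cr (2 * (p - a) + 1) w))
  (fun a w => an (2 * - (a - p) + 1) (an (2 * - (- p - (a - p))) w))) => a.
rewrite (_ : 2 * - (a - p) + 1 = 2 * (p - a) + 1); last lia.
rewrite (_ : 2 * - (- p - (a - p)) = 2 * a); last lia.
by apply: (@adjoint_comp _ _ (cr (2 * a)) _ (cr _)); apply: creation_adjoint.
Qed.

Lemma f_linear p : linear (f p).
Proof.
move=> a u v; have [N1 h1] := fE p u; have [N2 h2] := fE p v.
have [N3 h3] := fE p (a *: u + v).
rewrite (h1 (window (N1 + N2 + N3))) ?(h2 (window (N1 + N2 + N3)))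
  ?(h3 (window (N1 + N2 + N3))) ?window_uniq //; try by apply: window_sub; lia.
rewrite scaler_sumr -big_split; apply: eq_bigr => c _.
by rewrite !lan.
Qed.

Lemma f_e_adjoint p : adjoint (f p) (e (- p)).
Proof. by apply: adjoint_sym; rewrite -{2}[p]opprK; apply: e_f_adjoint. Qed.

Let ann_adjoint n : adjoint (an n) (cr n).
Proof. by apply: adjoint_sym; apply: creation_adjoint. Qed.

Lemma f_ann p n u : f p (an n u) = an n (f p u).
Proof.
move: u; apply: adjoint_eq (adjoint_comp (f_e_adjoint p) (ann_adjoint n))
  (adjoint_comp (ann_adjoint n) (f_e_adjoint p)) _ => u.
by rewrite e_create.
Qed.

(** Adjoint to [e_ann] for the mode - p. *)
Lemma f_create p n u : f p (cr n u) = cr n (f p u) + parity_sign n *: an (1 - 2 * p - n) u.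
Proof.
move: u; apply: adjoint_eq (adjoint_comp (f_e_adjoint p) (creation_adjoint n))
  (adjoint_add (adjoint_comp (creation_adjoint n) (f_e_adjoint p))
     (adjoint_scale (parity_sign n) (ann_adjoint _))) _ => u.
rewrite e_ann /parity_sign rmorph_sign.
by rewrite (_ : 1 - 2 * p - n = 2 * - p + 1 - n) ?subrK //; lia.
Qed.
End Currents.

Lemma int_step_ind (P : int -> Prop) :
  P 0 -> (forall m, P m -> P (m + 1)) -> (forall m, P (m + 1) -> P m) -> forall m, P m.
Proof.
move=> P0 up down; elim/int_ind => // n Pn.
  by rewrite -addn1 PoszD; apply: up.
by apply: down; rewrite -addn1 PoszD opprD subrK.
Qed.

(** * The affine relations on F *)
HB.lock Definition comm_ef (K : fieldType) (i j : int) (u : F K) : F K :=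
  cur_e i (cur_f j u) - cur_f j (cur_e i u).

Section Brackets.
Variable K : numClosedFieldType.
Local Notation F := (F K).
Local Notation cr := (@creation K).
Local Notation an := (@annihilation K).
Local Notation e := (@cur_e K).
Local Notation f := (@cur_f K).
Local Notation vac := (@vac K).
Local Notation parity_sign := (@parity_sign K).
Ltac lmod := lmod_with K constr:(Defs.F K : lmodType K).

Let lcr n : linear (cr n) := @creation_linear K n.
Let lan n : linear (an n) := @annihilation_linear K n.
Let le p : linear (e p) := @e_linear K p.
Let lf p : linear (f p) := @f_linear K p.

Local Notation G := (@comm_ef K).

Lemma GE i j u : G i j u = e i (f j u) - f j (e i u).
Proof. by rewrite unlock. Qed.

Lemma G_linear i j : linear (G i j).
Proof.
suff l : linear (fun u => e i (f j u) - f j (e i u)) by move=> a u v; rewrite !GE l.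
by apply: lin_sub; apply: lin_comp.
Qed.

Lemma G_create i j c u : G i j (cr c u) = cr c (G i j u) + cr (c + 2 * (i + j)) u.
Proof.
have sgE : parity_sign (1 - 2 * j - c) = - parity_sign c.
  by rewrite -(parity_sign_reflect _ (- j)); congr (parity_sign _); lia.
have iE : 2 * i + 1 - (1 - 2 * j - c) = c + 2 * (i + j) by lia.
rewrite !GE f_create (linD (le i)) (linZ (le i)) !e_create e_ann f_create.
rewrite (linB (lcr c)) sgE iE scalerBr scalerA mulrN parity_signM.
move: (1 - _ - _) (_ + 2 * _) => x y; lmod.
Qed.

Lemma G_ann i j c u : G i j (an c u) = an c (G i j u) - an (c - 2 * (i + j)) u.
Proof.
have sgE : parity_sign (2 * i + 1 - c) = - parity_sign c by rewrite parity_sign_reflect.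
have iE : 1 - 2 * j - (2 * i + 1 - c) = c - 2 * (i + j) by lia.
rewrite !GE f_ann !e_ann (linB (lf j)) (linZ (lf j)) f_ann f_create.
rewrite (linB (lan c)) sgE iE scalerDr scalerA mulrN parity_signM.
move: (2 * _ + _ - _) (_ - 2 * _) => x y; lmod.
Qed.

Lemma e_vac0 p m : p <= m -> e p (vac m) = 0.
Proof.
move=> pm; have [N /(_ (window N) (window_uniq N))->] := eE p (vac m) => //.
apply: big1_seq => a _; have [h|h] := leP (2 * (p - a) + 1) m.
  by rewrite (creation_vac0 _ h) (lin0 (lcr _)).
rewrite creation_anticomm (@creation_vac0 _ (2 * a) m) ?(lin0 (lcr _)) ?oppr0 //; lia.
Qed.

Lemma f_vac0 p m : p <= - m -> f p (vac m) = 0.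
Proof.
move=> pm; have [N /(_ (window N) (window_uniq N))->] := fE p (vac m) => //.
apply: big1_seq => a _; have [h|h] := ltP m (2 * - (p - a)).
  by rewrite (annihilation_vac0 _ h) (lin0 (lan _)).
rewrite annihilation_anticomm (@annihilation_vac0 _ (2 * - a + 1) m) ?(lin0 (lan _)) ?oppr0 //; lia.
Qed.

(** The statement holds at v(0), where e_n and f_0 vanish, and propagates in both
    directions because a creation or annihilation operator leads from v(m) to
    v(m + 1) and back. *)
Lemma h_vac n m : n <= 0 ->
  G n 0 (vac m) = ((n == 0)%:R * m%:~R) *: vac m.
Proof.
move=> n0; elim/int_step_ind: m => [|m IH|m].
- by rewrite GE !(e_vac0, f_vac0) // (lin0 (le n)) (lin0 (lf 0)) subrr mulr0 scale0r.
- have [c c0 [crE anE]] := vac_step K m.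
  apply: (scalerI c0); rewrite -(linZ (@G_linear n 0)) -crE G_create IH (linZ (lcr _)).
  rewrite [RHS]scalerA [c * _]mulrC -[RHS]scalerA -crE addr0.
  case: eqP => [->|/eqP nn0]; rewrite ?mulr0 ?addr0 ?mul1r ?mul0r.
    by rewrite intrD scalerDl scale1r.
  rewrite !scale0r add0r creation_vac0 //; lia.
have [c c0 [crE anE]] := vac_step K m => IH.
apply: (scalerI c0); rewrite -(linZ (@G_linear n 0)) -anE G_ann IH (linZ (lan _)).
rewrite [RHS]scalerA [c * _]mulrC -[RHS]scalerA -anE addr0.
case: eqP => [->|/eqP nn0]; rewrite ?mulr0 ?subr0 ?mul1r ?mul0r.
  by rewrite intrD scalerDl scale1r addrK.
rewrite !scale0r sub0r annihilation_vac0 ?oppr0 //; lia.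
Qed.

Lemma G_adjoint i j : adjoint (G i j) (G (- j) (- i)).
Proof.
move=> u v; rewrite !GE; move: u v.
by apply: adjoint_add; [|apply: adjoint_opp]; apply: adjoint_comp;
  (apply: e_f_adjoint || apply: f_e_adjoint).
Qed.

(** Both sides have the same commutators with the fermions. When i + j <= 0 they
    are compared at v(i), which is killed by e_i and f_j, whereas h_0 has eigenvalue
    i on it: this is the central term. When i + j > 0, the adjoint relation is of
    the first kind. *)
Lemma bracket_ef i j u : G i j u = G (i + j) 0 u - (i%:~R * (i + j == 0)%:R) *: u.
Proof.
wlog ij : i j u / i + j <= 0 => [main|].
  have [ij|ij] := leP (i + j) 0; first exact: main.
  rewrite (_ : (i + j == 0) = false) ?mulr0 ?scale0r ?subr0; last by lia.
  move: u; apply: adjoint_eq (G_adjoint i j) (G_adjoint (i + j) 0) _ => u.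
  have jiE : - j - i = - (i + j) by lia.
  have nz : (- (i + j) == 0) = false by lia.
  have le0 : - (i + j) <= 0 by lia.
  have nzE : (- j - i == 0) = false by rewrite jiE.
  have le0' : - j - i <= 0 by rewrite jiE.
  have := main 0 (- (i + j)) u; rewrite sub0r nz mulr0n mulr0 scale0r subr0 => /(_ le0) e2.
  have := main (- j) (- i) u le0'; rewrite nzE mulr0n mulr0 scale0r subr0 jiE => e1.
  by rewrite oppr0 e1 e2.
apply/eqP; rewrite addrC -subr_eq; apply/eqP; rewrite -scaleNr; move: u.
apply: (@eq_scalar_of_commuting _ (fun u => G i j u - G (i + j) 0 u) i).
- by apply: lin_sub; apply: G_linear.
- by move=> n u; rewrite !G_create addr0 (linB (lcr n)); lmod.
- by move=> n u; rewrite !G_ann addr0 (linB (lan n)); lmod.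
rewrite h_vac // GE e_vac0 // f_vac0; last lia.
by rewrite (lin0 (le i)) (lin0 (lf j)) subrr sub0r -scaleNr mulrC.
Qed.

Lemma e_comm p q u : e p (e q u) = e q (e p u).
Proof.
apply/eqP; rewrite -subr_eq0 -[eqbRHS](scale0r u); apply/eqP; move: u.
apply: (@eq_scalar_of_commuting _ (fun u => e p (e q u) - e q (e p u)) (`|p| + `|q|)%N%:Z).
- by apply: lin_sub; apply: lin_comp.
- by move=> n u; rewrite !e_create (linB (lcr n)).
- move=> n u; rewrite !e_ann (linB (le p)) (linB (le q)) !(linZ (le _)) !e_create !e_ann.
  by rewrite (linB (lan n)); lmod.
rewrite !e_vac0; try lia.
by rewrite (lin0 (le p)) (lin0 (le q)) subrr scale0r.
Qed.

(** For n <= 0 the operators are compared at v(m) for a large m, which is an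
    eigenvector of h_n. For n > 0, writing h_n = [e_{n+i}, f_{-i}] turns the bracket
    with e_i into the bracket of h_0 with e_{n+i}. *)
Lemma bracket_he n i u : G n 0 (e i u) - e i (G n 0 u) = 2 *: e (n + i) u.
Proof.
have main (m j : int) u' : m <= 0 -> G m 0 (e j u') - e j (G m 0 u') = 2 *: e (m + j) u'.
  move=> m0; apply/eqP; rewrite -subr_eq0 -[eqbRHS](scale0r u'); apply/eqP; move: u'.
  apply: (@eq_scalar_of_commuting _ (fun v => G m 0 (e j v) - e j (G m 0 v) - 2 *: e (m + j) v)
    (`|j| + `|(m + j)%R|)%N%:Z).
  - apply: lin_sub; last exact: lin_scale.
    by apply: lin_sub; apply: lin_comp => //; apply: G_linear.
  - move=> c u'; rewrite !(e_create, G_create) (linD (le _)) !e_create.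
    by rewrite !(linB (lcr c)) (linZ (lcr c)); lmod.
  - move=> c u'; rewrite !(e_ann, G_ann) (linB (G_linear _ _)) (linZ (G_linear _ _)).
    rewrite (linB (le _)) G_ann !e_ann G_create !(linB (lan c)) (linZ (lan c)).
    rewrite (_ : parity_sign (c - 2 * (m + 0)) = parity_sign c); last first.
      by rewrite -[RHS]opprK -(parity_sign_reflect _ 0) -(parity_sign_reflect _ (- m));
        congr parity_sign; lia.
    rewrite (_ : 2 * j + 1 - c + 2 * (m + 0) = 2 * (m + j) + 1 - c); last by lia.
    rewrite (_ : 2 * j + 1 - (c - 2 * (m + 0)) = 2 * (m + j) + 1 - c); last by lia.
    move: (c - _) (2 * _ + _ - _) (2 * _ + _ - _) => x y z; lmod.
  rewrite h_vac // (linZ (le j)) !e_vac0; try lia.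
  by rewrite (lin0 (G_linear _ _)) !scaler0 !subr0 scale0r.
have [n0|n0] := leP n 0; first exact: main.
have hE v : G n 0 v = e (n + i) (f (- i) v) - f (- i) (e (n + i) v).
  have := bracket_ef (n + i) (- i) v; rewrite addrK (_ : (n == 0) = false); last lia.
  by rewrite mulr0n mulr0 scale0r subr0 GE => <-.
have eK v : e i (f (- i) v) = f (- i) (e i v) + (G 0 0 v - i%:~R *: v).
  by have := bracket_ef i (- i) v; rewrite subrr eqxx mulr1 GE => <-; rewrite addrC subrK.
have := main 0 (n + i) u (lexx 0); rewrite add0r => <-.
rewrite !hE (linB (le i)) [e i (e _ (f _ _))]e_comm !eK (e_comm i).
rewrite (linD (le _)) (linB (le _)) (linZ (le _)).
set w := e (n + i) u; set w1 := e _ (f _ _); set w2 := f _ _; set w3 := G 0 0 w.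
by set w4 := e _ (G _ _ _); lmod.
Qed.

Lemma f_comm p q u : f p (f q u) = f q (f p u).
Proof.
move: u; apply: adjoint_eq (adjoint_comp (f_e_adjoint p) (f_e_adjoint q))
  (adjoint_comp (f_e_adjoint q) (f_e_adjoint p)) _ => u.
exact: e_comm.
Qed.

Lemma h_adjoint n : adjoint (G n 0) (G (- n) 0).
Proof.
move=> u v; rewrite G_adjoint oppr0 bracket_ef add0r.
by rewrite mul0r scale0r subr0.
Qed.

Lemma bracket_hf n i u : G n 0 (f i u) - f i (G n 0 u) = - (2 *: f (n + i) u).
Proof.
have hA := h_adjoint n; have fA := f_e_adjoint i.
move: u; apply: (@adjoint_eq _ _ (fun u => G n 0 (f i u) - f i (G n 0 u))
  (fun u => e (- i) (G (- n) 0 u) - G (- n) 0 (e (- i) u)) (fun u => - (2 *: f (n + i) u))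
  (fun u => - (2^* *: e (- (n + i)) u))).
- by apply: adjoint_add; [|apply: adjoint_opp]; apply: adjoint_comp.
- by apply: adjoint_opp; apply: adjoint_scale; apply: f_e_adjoint.
by move=> u; rewrite -opprB bracket_he rmorph_nat opprD.
Qed.

Lemma bracket_hh n m u : G n 0 (G m 0 u) - G m 0 (G n 0 u) =
  - (n%:~R * (n + m == 0)%:R * 2) *: u.
Proof.
have he v j : G n 0 (e j v) = e j (G n 0 v) + 2 *: e (n + j) v.
  by rewrite -bracket_he addrC subrK.
have hf v j : G n 0 (f j v) = f j (G n 0 v) - 2 *: f (n + j) v.
  by rewrite -bracket_hf addrC subrK.
have hhE : G n 0 (G m 0 u) - G m 0 (G n 0 u) = 2 *: G (n + m) 0 u - 2 *: G m n u.
  rewrite !(GE m) (linB (G_linear _ _)) he !hf he (linB (le m)) (linD (lf 0)).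
  rewrite (linZ (le m)) (linZ (lf 0)) !addr0 (GE (n + m)); lmod.
have mnE : G (m + n) 0 u = G (n + m) 0 u by congr (G _ _ _); lia.
have mn0 : (m + n == 0) = (n + m == 0) by lia.
rewrite hhE (bracket_ef m n) mnE mn0 scalerBr opprB addrC subrK scalerA.
congr (_ *: _); case: eqP => [nm|_]; last by rewrite /= !mulr0n !mulr0 mul0r oppr0.
have -> : m = - n by lia.
by rewrite rmorphN /= mulr1n; ring.
Qed.

Lemma iter_e_ann p n r u : iter r.+1 (e p) (an n u) =
  an n (iter r.+1 (e p) u) - (r.+1%:R * parity_sign n) *: cr (2 * p + 1 - n) (iter r (e p) u).
Proof.
elim: r u => [|r IH] u; first by rewrite /= e_ann mul1r.
rewrite iterS IH (linB (le p)) (linZ (le p)) e_ann e_create -!iterS.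
set w := an n _; set w' := cr _ _; rewrite -[r.+2]addn1 natrD; lmod.
Qed.

(** Here v(p - N) is lowest in its sl_2-string for e_p and v(p + N) is highest.
    The induction removes the last factor of v(p - N): commuting the annihilation
    operator with the power of e_p leaves the creation operator of the partner
    variable, which is the next factor of v(p + N). *)
Lemma iter_e_vac p N : iter N.+1 (e p) (vac (p - N%:Z)) = 0 /\
  exists2 c : K, c != 0 & iter N (e p) (vac (p - N%:Z)) = c *: vac (p + N%:Z).
Proof.
elim: N => [|N [IH0 [c c0 IHc]]].
  have -> : p + 0%N%:Z = p by lia.
  have e0 : e p (vac p) = 0 by exact: e_vac0.
  rewrite /= e0; split=> //.
  by exists 1; rewrite ?oner_neq0 ?scale1r.
have [b b0 [_ anE]] := vac_step K (p - N.+1%:Z).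
have pE : p - N.+1%:Z + 1 = p - N%:Z by lia.
have qE : 2 * p + 1 - (p - N%:Z) = p + N%:Z + 1 by lia.
have [d d0 [crE _]] := vac_step K (p + N%:Z).
have rE : p + N%:Z + 1 = p + N.+1%:Z by lia.
rewrite pE in anE; rewrite rE in crE.
have sE r : b *: iter r (e p) (vac (p - N.+1%:Z)) = iter r (e p) (an (p - N%:Z) (vac (p - N%:Z))).
  by rewrite anE (linZ (lin_iter _ (le p))).
have i0 r : iter r.+1 (e p) 0 = 0 := lin0 (lin_iter r.+1 (le p)).
split.
  apply: (scalerI b0); rewrite sE iter_e_ann.
  by rewrite iterS IH0 (lin0 (le p)) (lin0 (lan _)) (lin0 (lcr _)) !scaler0 subr0.
exists (- b^-1 * N.+1%:R * parity_sign (p - N%:Z) * c * d).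
  by rewrite !mulf_neq0 ?oppr_eq0 ?invr_eq0 ?pnatr_eq0 ?signr_eq0.
apply: (scalerI b0); rewrite sE iter_e_ann IH0 IHc (lin0 (lan _)) qE rE (linZ (lcr _)) crE.
rewrite sub0r !scalerA -scaleNr; congr (_ *: _); field.
exact: b0.
Qed.
End Brackets.

(** * The tensor power of F *)
Section FModule.
Variable K : numClosedFieldType.

Lemma F_loopE x n (v : F K) : loop (F_action K) x n v =
  (x : 'M_2) 0 1 *: cur_e n v + (x : 'M_2) 1 0 *: cur_f n v + (x : 'M_2) 0 0 *: comm_ef n 0 v.
Proof. by rewrite GE [cur_e]unlock [cur_f]unlock. Qed.

Lemma F_loop_e n (v : F K) : loop (F_action K) (sl2_e K) n v = cur_e n v.
Proof. by rewrite F_loopE !sl2_eE !scale0r scale1r !addr0. Qed.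
Lemma F_loop_f n (v : F K) : loop (F_action K) (sl2_f K) n v = cur_f n v.
Proof. by rewrite F_loopE !sl2_fE !scale0r scale1r add0r addr0. Qed.
Lemma F_loop_h n (v : F K) : loop (F_action K) (sl2_h K) n v = comm_ef n 0 v.
Proof. by rewrite F_loopE !sl2_hE !scale0r scale1r !add0r. Qed.

Lemma F_module : is_module (F_action K).
Proof.
apply: (is_module_from_relations F_loopE) => //=.
- exact: e_linear.
- exact: f_linear.
- by move=> n; apply: G_linear.
- exact: e_comm.
- exact: f_comm.
- by move=> i j v; rewrite -bracket_ef GE.
- exact: bracket_he.
- exact: bracket_hf.
exact: bracket_hh.
Qed.
End FModule.

HB.lock Definition factor_op (K : fieldType) (k : nat) (j : 'I_k) (X : F K -> F K) :
  Ftensor K k -> Ftensor K k := on_factor j X.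
(** The linear map u |-> T_1 (x) ... (x) u (x) ... (x) T_k, with [u] at place
    [j]. *)
HB.lock Definition embed (K : fieldType) (k : nat) (j : 'I_k) (T : {ffun 'I_k -> state}) :
  F K -> Ftensor K k :=
  lin_ext (fun S : state => << [ffun l => if l == j then S else T l] >> : Ftensor K k).

Section Factors.
Variables (K : fieldType) (k : nat).
Local Notation F := (F K).
Local Notation FT := (Ftensor K k).
Local Notation factor_op := (@factor_op K k).
Local Notation embed := (@embed K k).
Implicit Types (j l : 'I_k) (T : {ffun 'I_k -> state}) (X Y : F -> F) (v : FT).

Definition upd T j (S : state) : {ffun 'I_k -> state} := [ffun l => if l == j then S else T l].

Lemma factor_op_linear j X : linear (factor_op j X).
Proof. rewrite unlock; exact: lin_ext_linear. Qed.
Lemma embed_linear j T : linear (embed j T).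
Proof. rewrite unlock; exact: lin_ext_linear. Qed.
Lemma factor_opU j X T : factor_op j X << T >> = embed j T (X << T j >>).
Proof. by rewrite factor_op.unlock /on_factor lin_extU embed.unlock. Qed.
Lemma embedU j T S : embed j T << S >> = << upd T j S >>.
Proof. by rewrite embed.unlock lin_extU. Qed.
Lemma embed_upd j T S : embed j (upd T j S) = embed j T.
Proof.
apply: funext => u; move: u; apply: lin_eq => [||S']; try exact: embed_linear.
rewrite !embedU; congr << _ >>; apply/ffunP => l; rewrite !ffunE.
by case: eqP.
Qed.

Lemma factor_op_embed j X T u : linear X -> factor_op j X (embed j T u) = embed j T (X u).
Proof.
move=> lX; move: u; apply: lin_eq => [||S].
- exact: lin_comp (factor_op_linear j X) (embed_linear j T).
- exact: lin_comp (embed_linear j T) lX.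
by rewrite embedU factor_opU embed_upd ffunE eqxx.
Qed.

Lemma factor_op_comp j X Y v : linear X ->
  factor_op j X (factor_op j Y v) = factor_op j (fun u => X (Y u)) v.
Proof.
move=> lX; move: v; apply: lin_eq => [||T].
- exact: lin_comp (factor_op_linear j X) (factor_op_linear j Y).
- exact: factor_op_linear.
by rewrite !factor_opU factor_op_embed.
Qed.

Lemma factor_op_id j v : factor_op j id v = v.
Proof.
move: v; apply: lin_eq => [||T]; [exact: factor_op_linear|by []|].
rewrite factor_opU embedU; congr << _ >>; apply/ffunP => l; rewrite !ffunE.
by case: eqP => [->|].
Qed.

Lemma factor_op_lin j X Y a v :
  factor_op j (fun u => a *: X u + Y u) v = a *: factor_op j X v + factor_op j Y v.
Proof.
move: v; apply: lin_eq => [||T]; first exact: factor_op_linear.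
  apply: lin_add; last exact: factor_op_linear.
  by apply: lin_scale; apply: factor_op_linear.
by rewrite !factor_opU embed_linear.
Qed.

(** Evaluated on a basis tensor, both sides are the same bilinear expression in the
    images of its factors number [j] and [l]. *)
Lemma factor_op_comm j l X Y v : j != l -> linear X -> linear Y ->
  factor_op j X (factor_op l Y v) = factor_op l Y (factor_op j X v).
Proof.
move=> jl lX lY; move: v; apply: lin_eq => [||T].
- exact: lin_comp (factor_op_linear _ _) (factor_op_linear _ _).
- exact: lin_comp (factor_op_linear _ _) (factor_op_linear _ _).
rewrite !factor_opU.
have facE i i' Z u : i != i' -> factor_op i Z (embed i' T u) =
    lin_ext (fun S => embed i (upd T i' S) (Z << T i >>)) u.
  move=> ii'; move: u; apply: lin_eq => [||S].
  - exact: lin_comp (factor_op_linear _ _) (embed_linear _ _).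
  - exact: lin_ext_linear.
  by rewrite embedU factor_opU lin_extU ffunE (negPf ii').
have lj : l != j by rewrite eq_sym.
rewrite (facE _ _ X _ jl) (facE _ _ Y _ lj); move: (X _) (Y _) => x y; move: x.
apply: lin_eq => [||S].
- move=> a u v; rewrite /lin_ext scaler_sumr -big_split; apply: eq_bigr => S _.
  by rewrite embed_linear scalerDr !scalerA mulrC.
- exact: lin_ext_linear.
rewrite lin_extU; move: y; apply: lin_eq => [||S']; try exact: embed_linear.
  exact: lin_ext_linear.
rewrite lin_extU !embedU; congr << _ >>; apply/ffunP => i; rewrite !ffunE.
by case: eqP => [->|//]; rewrite (negPf jl).
Qed.

Lemma iter_factor_op r j X T : linear X ->
  iter r (factor_op j X) << T >> = embed j T (iter r X << T j >>).
Proof.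
move=> lX; elim: r => [|r IH] /=; last by rewrite IH factor_op_embed.
rewrite embedU; congr << _ >>; apply/ffunP => i; rewrite !ffunE.
by case: eqP => [->|].
Qed.
End Factors.

Section FactorAdjoint.
Variables (K : numClosedFieldType) (k : nat).
Implicit Types (j : 'I_k) (T : {ffun 'I_k -> state}).

Lemma hform_embed j T (T' : {ffun 'I_k -> state}) (u : F K) :
  hform (embed j T u : Ftensor K k) << T' >> =
  [forall l, (l != j) ==> (T l == T' l)]%:R * hform u << T' j >>.
Proof.
move: u; apply: (@lin_eq _ _ (K^o)) => [||S].
- exact: lin_comp (@hform_lin _ _ _) (embed_linear j T).
- exact: (lin_scale _ (@hform_lin _ _ _)).
rewrite embedU !hformUU -natrM mulnb; congr (nat_of_bool _)%:R.
apply/eqP/andP => [<-|[/forallP TT' /eqP ST]].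
  rewrite ffunE eqxx; split=> //; apply/forallP => l; apply/implyP => /negPf lj.
  by rewrite ffunE lj.
apply/ffunP => l; rewrite ffunE; case: eqP => [->//|/eqP lj].
by have /implyP/(_ lj)/eqP := TT' l.
Qed.

Lemma factor_op_adjoint j (X Y : F K -> F K) : linear X -> linear Y -> adjoint X Y ->
  adjoint (factor_op j X : Ftensor K k -> Ftensor K k) (factor_op j Y).
Proof.
move=> lX lY XY; apply: adjoint_basis => [||T T']; try exact: factor_op_linear.
have -> : hform << T >> (factor_op j Y << T' >>) =
    (hform (factor_op j Y << T' >>) << T >>)^*
  by exact: hformC.
rewrite !factor_opU !hform_embed rmorphM /= -hformC rmorph_nat XY.
congr ((nat_of_bool _)%:R * _); apply: eq_forallb => l.
by rewrite [T' l == _]eq_sym.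
Qed.
End FactorAdjoint.

HB.lock Definition tensor_rep (K : fieldType) (k : nat) : action (Ftensor K k) := tensor_action K k.

Section TensorModule.
Variables (K : numClosedFieldType) (k : nat).
Local Notation FT := (Ftensor K k).
Local Notation T := (tensor_rep K k).
Local Notation FA := (F_action K).

Lemma tensor_loopE x n (v : FT) : loop T x n v = \sum_(j < k) factor_op j (loop FA x n) v.
Proof. by rewrite tensor_rep.unlock factor_op.unlock. Qed.

Lemma tensor_cent (v : FT) : cent T v = k%:R *: v.
Proof.
rewrite tensor_rep.unlock /= (eq_bigr (fun _ => v));
  first by rewrite sumr_const card_ord scaler_nat.
by move=> j _; rewrite -[RHS](factor_op_id j) factor_op.unlock.
Qed.

(** Operators on distinct factors commute, so only the diagonal terms remain. The
    combination with - 1 has the shape to which [factor_op_lin] applies. *)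
Lemma tensor_comm (X Y : F K -> F K) (v : FT) : linear X -> linear Y ->
  (\sum_(j < k) factor_op j X (\sum_(l < k) factor_op l Y v)) -
    (\sum_(j < k) factor_op j Y (\sum_(l < k) factor_op l X v)) =
  \sum_(j < k) factor_op j (fun u => - 1 *: Y (X u) + X (Y u)) v.
Proof.
move=> lX lY.
rewrite (eq_bigr (fun j => \sum_(l < k) factor_op j X (factor_op l Y v))) => [|j _]; last first.
  exact: (lin_sum (factor_op_linear j X)).
rewrite [X in _ - X](eq_bigr (fun j => \sum_(l < k) factor_op j Y (factor_op l X v)))
  => [|j _]; last first.
  exact: (lin_sum (factor_op_linear j Y)).
rewrite [X in _ - X]exchange_big -sumrB; apply: eq_bigr => j _ /=.
rewrite -sumrB (bigD1 j) //= big1 ?addr0 => [|l lj]; last first.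
  by rewrite (factor_op_comm v _ lX lY) ?subrr // eq_sym.
by rewrite (factor_op_comp _ _ _ lX) (factor_op_comp _ _ _ lY) factor_op_lin scaleN1r addrC.
Qed.

Lemma tensor_module : is_module T.
Proof.
have FM := F_module K; have lFA x n := loop_linear FM x n.
have lT x n : linear (loop T x n).
  move=> a u v; rewrite !tensor_loopE scaler_sumr -big_split; apply: eq_bigr => j _.
  exact: factor_op_linear.
split; first exact: lT.
- by move=> a u v; rewrite !tensor_cent scalerDr !scalerA mulrC.
- move=> n v a x y; rewrite !tensor_loopE scaler_sumr -big_split; apply: eq_bigr => j _.
  transitivity (factor_op j (fun u => a *: loop FA x n u + loop FA y n u) v).
    congr (factor_op j _ v); apply: funext => u.
    exact: loop_linear_sl2.
  exact: factor_op_lin.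
- by move=> x n v; rewrite !tensor_cent (linZ (lT x n)).
move=> x y m n v; rewrite tensor_cent !tensor_loopE tensor_comm //.
set c := _ * _ * _; set z := sl2_bracket x y.
have -> : \sum_(j < k) factor_op j (loop FA z (m + n)) v - c *: (k%:R *: v) =
    \sum_(j < k) (- c *: factor_op j id v + factor_op j (loop FA z (m + n)) v).
  rewrite big_split /= addrC; congr (_ + _).
  rewrite (eq_bigr (fun _ => - c *: v)) => [|j _]; last by rewrite factor_op_id.
  by rewrite sumr_const card_ord !scalerA -scaler_nat scalerA mulrN scaleNr mulrC.
apply: eq_bigr => j _.
transitivity (factor_op j (fun u => - c *: id u + loop FA z (m + n) u) v);
  last exact: factor_op_lin.
apply: (congr1 (fun X => factor_op j X v)); apply: funext => u.
have h : loop FA x m (loop FA y n u) - loop FA y n (loop FA x m u) =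
  loop FA z (m + n) u - c *: u := loop_bracket FM x y m n u.
by rewrite scaleN1r scaleNr addrC h addrC.
Qed.
End TensorModule.

(** In the binomial expansion only one term survives, the other ones containing
    too high a power of [A] or of [B]. *)
Lemma iter_add_commuting (K : fieldType) (V : lmodType K) (A B : V -> V) (a b : nat) (w : V) :
  linear A -> linear B -> (forall u, A (B u) = B (A u)) ->
  iter a.+1 A w = 0 -> iter b.+1 B w = 0 ->
  iter (a + b) (fun u => A u + B u) w = 'C(a + b, a)%:R *: iter a A (iter b B w) /\
  iter (a + b).+1 (fun u => A u + B u) w = 0.
Proof.
move=> lA lB AB.
have lS : linear (fun u => A u + B u) by apply: lin_add.
have AiB r u : A (iter r B u) = iter r B (A u) by elim: r => //= r <-.
have BiA r u : B (iter r A u) = iter r A (B u) by elim: r => //= r <-.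
have i0 (X : V -> V) r : linear X -> iter r X 0 = 0.
  by move=> lX; elim: r => //= r ->; rewrite (lin0 lX).
have killA r u : A u = 0 -> iter r (fun u => A u + B u) u = iter r B u.
  by move=> Au; elim: r => //= r ->; rewrite AiB Au i0 // add0r.
have killB r u : B u = 0 -> iter r (fun u => A u + B u) u = iter r A u.
  by move=> Bu; elim: r => //= r ->; rewrite BiA Bu i0 // addr0.
have [n nab] := ubnP (a + b)%N; elim: n => // n IH in a b w nab *.
case: a nab => [|a] nab Aw Bw.
  by rewrite add0n !(killA _ _ Aw) Bw bin0 scale1r.
case: b nab Bw => [|b] nab Bw.
  by rewrite addn0 !(killB _ _ Bw) Aw binn scale1r.
have SE r u : iter r.+1 (fun u => A u + B u) u =
    iter r (fun u => A u + B u) (A u) + iter r (fun u => A u + B u) (B u).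
  by rewrite iterSr (linD (lin_iter r lS)).
have [e1 z1] : iter (a + b.+1) (fun u => A u + B u) (A w) =
      'C(a + b.+1, a)%:R *: iter a A (iter b.+1 B (A w)) /\
    iter (a + b.+1).+1 (fun u => A u + B u) (A w) = 0.
  apply: IH; rewrite ?[iter a.+1 _ _]/=; first by move: nab; rewrite addSn ltnS.
    by rewrite -iterSr.
  by rewrite -AiB Bw (lin0 lA).
have [e2 z2] : iter (a.+1 + b) (fun u => A u + B u) (B w) =
      'C(a.+1 + b, a.+1)%:R *: iter a.+1 A (iter b B (B w)) /\
    iter (a.+1 + b).+1 (fun u => A u + B u) (B w) = 0.
  apply: IH; first by move: nab; rewrite addnS ltnS.
    by rewrite -BiA Aw (lin0 lB).
  by rewrite -iterSr.
have NE : (a.+1 + b = a + b.+1)%N by rewrite addSnnS.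
rewrite NE in e2 z2; rewrite addSn; set N := (a + b.+1)%N in e1 z1 e2 z2 *.
split; last by rewrite SE z1 z2 addr0.
rewrite SE e1 e2 -!AiB -!iterSr -scalerDl -natrD binS addnC; do 2!congr (_ *: _).
Qed.

Definition vacs (k : nat) (m : 'I_k -> int) : {ffun 'I_k -> state} :=
  [ffun j => vac_state (m j)].
HB.lock Definition extremal (K : fieldType) (k : nat) (m : 'I_k -> int) : Ftensor K k :=
  << vacs m >>.

(** * Extremal vectors and their reflections *)
Section Extremal.
Variables (K : numClosedFieldType) (k : nat).
Local Notation FT := (Ftensor K k).
Local Notation T := (tensor_rep K k).
Local Notation FA := (F_action K).
Local Notation E := (loop T (sl2_e K)).
Local Notation F := (loop T (sl2_f K)).
Local Notation H := (loop T (sl2_h K)).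
Implicit Types (m : 'I_k -> int) (p n : int).

Local Notation extremal := (@extremal K k).

Lemma tensorE n v : E n v = \sum_(j < k) factor_op j (cur_e n) v.
Proof.
rewrite tensor_loopE; apply: eq_bigr => j _.
by apply: (congr1 (fun X => factor_op j X v)); apply: funext => u; apply: F_loop_e.
Qed.
Lemma tensorF n v : F n v = \sum_(j < k) factor_op j (cur_f n) v.
Proof.
rewrite tensor_loopE; apply: eq_bigr => j _.
by apply: (congr1 (fun X => factor_op j X v)); apply: funext => u; apply: F_loop_f.
Qed.
Lemma tensorH n v : H n v = \sum_(j < k) factor_op j (comm_ef n 0) v.
Proof.
rewrite tensor_loopE; apply: eq_bigr => j _.
by apply: (congr1 (fun X => factor_op j X v)); apply: funext => u; apply: F_loop_h.
Qed.

Lemma eq_extremal m m' : (forall j, m j = m' j) -> extremal m = extremal m'.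
Proof. by move=> mm; rewrite (_ : m = m') //; apply: funext. Qed.

Lemma factor_op_extremal j (X : Defs.F K -> Defs.F K) m :
  factor_op j X (extremal m) = embed j (vacs m) (X (vac K (m j))).
Proof. by rewrite extremal.unlock factor_opU ffunE. Qed.

Lemma embed_vac j m n : embed j (vacs m) (vac K n) = extremal (fun l => if l == j then n else m l).
Proof.
rewrite /vac embedU extremal.unlock; congr << _ >>; apply/ffunP => l; rewrite !ffunE.
by case: eqP.
Qed.

Lemma embed_vac_id j m : embed j (vacs m) (vac K (m j)) = extremal m.
Proof.
rewrite embed_vac; apply: eq_extremal => l.
by case: eqP => [->|].
Qed.

Lemma E_extremal0 n m : (forall j, n <= m j) -> E n (extremal m) = 0.
Proof.
move=> nm; rewrite tensorE big1 // => j _.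
by rewrite factor_op_extremal e_vac0 // (lin0 (embed_linear _ _)).
Qed.
Lemma F_extremal0 n m : (forall j, n <= - m j) -> F n (extremal m) = 0.
Proof.
move=> nm; rewrite tensorF big1 // => j _.
by rewrite factor_op_extremal f_vac0 // (lin0 (embed_linear _ _)).
Qed.
Lemma H_extremal n m : n <= 0 ->
  H n (extremal m) = ((n == 0)%:R * (\sum_j m j)%:~R) *: extremal m.
Proof.
move=> n0; rewrite tensorH (eq_bigr (fun j => ((n == 0)%:R * (m j)%:~R) *: extremal m)).
  by rewrite -scaler_suml -mulr_sumr rmorph_sum.
by move=> j _; rewrite factor_op_extremal h_vac // (linZ (embed_linear _ _)) embed_vac_id.
Qed.

Lemma factor_reflect j p m : m j <= p ->
  iter `|p - m j|.+1 (factor_op j (cur_e p)) (extremal m) = 0 /\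
  exists2 c : K, c != 0 & iter `|p - m j|%N (factor_op j (cur_e p)) (extremal m) =
    c *: extremal (fun l => if l == j then 2 * p - m j else m l).
Proof.
move=> mp; have le := @e_linear K p.
have [z [c c0 h]] := iter_e_vac K p `|p - m j|%N.
have e1 : p - `|p - m j|%N%:Z = m j by lia.
have e2 : p + `|p - m j|%N%:Z = 2 * p - m j by lia.
rewrite e1 in z h; rewrite e2 in h.
split; first by rewrite extremal.unlock iter_factor_op // ffunE z (lin0 (embed_linear _ _)).
by exists c => //; rewrite {1}extremal.unlock iter_factor_op // ffunE h
  (linZ (embed_linear _ _)) embed_vac.
Qed.

(** The factors are reflected one at a time, since the operators of distinct
    factors commute and each has its own nilpotency order on the vector. *)
Lemma reflect_on (r : seq 'I_k) p m : uniq r -> (forall j, m j <= p) ->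
  iter (\sum_(j <- r) `|(p - m j)%R|)%N.+1
    (fun v : FT => \sum_(j <- r) factor_op j (cur_e p) v) (extremal m) = 0 /\
  exists2 c : K, c != 0 & iter (\sum_(j <- r) `|(p - m j)%R|)%N
      (fun v : FT => \sum_(j <- r) factor_op j (cur_e p) v) (extremal m) =
    c *: extremal (fun l => if l \in r then 2 * p - m l else m l).
Proof.
move=> + mp; elim: r => [_|j r IH].
  rewrite !big_nil; split; first by rewrite /= big_nil.
  by exists 1; rewrite ?oner_neq0 ?scale1r.
rewrite cons_uniq => /andP[jr /IH[z [c c0 h]]].
set S := fun v : FT => _ in z h; set N := (\sum_(j <- r) _)%N in z h.
have le := @e_linear K p.
have lS : linear S by apply: lin_bigsum => l; apply: factor_op_linear.
have AS u : factor_op j (cur_e p) (S u) = S (factor_op j (cur_e p) u).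
  rewrite /S (lin_sum (factor_op_linear j _)); apply: eq_big_seq => l lr.
  by apply: factor_op_comm => //; apply: contraNneq jr => ->.
have [zj _] := factor_reflect (mp j).
have [eq zero] := iter_add_commuting (factor_op_linear j (cur_e p)) lS AS zj z.
have -> : (fun v : FT => \sum_(l <- j :: r) factor_op l (cur_e p) v) =
    (fun v => factor_op j (cur_e p) v + S v) by apply: funext => v; rewrite big_cons.
have -> : (\sum_(l <- j :: r) `|(p - m l)%R| = `|(p - m j)%R| + N)%N by rewrite big_cons.
split; first exact: zero.
rewrite eq h (linZ (lin_iter _ (factor_op_linear j (cur_e p)))).
pose m' := fun l => if l \in r then 2 * p - m l else m l.
have m'j : m' j = m j by rewrite /m' (negPf jr).
have m'p : m' j <= p by rewrite m'j.
have [_ [d d0]] := factor_reflect m'p; rewrite m'j => ->.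
exists ('C(`|p - m j| + N, `|p - m j|)%:R * c * d).
  by rewrite !mulf_neq0 // pnatr_eq0 -lt0n bin_gt0 leq_addr.
rewrite !scalerA; congr (_ *: _); apply: eq_extremal => l; rewrite inE /m'.
by case: eqP => [->|].
Qed.

Lemma reflect_E p m : (forall j, m j <= p) ->
  exists2 c : K, c != 0 & iter (\sum_j `|(p - m j)%R|)%N (E p) (extremal m) =
    c *: extremal (fun l => 2 * p - m l).
Proof.
move=> mp; have [_ [c c0 h]] := reflect_on (index_enum_uniq 'I_k) mp.
exists c; first exact: c0.
have -> : E p = (fun v : FT => \sum_(j < k) factor_op j (cur_e p) v).
  by apply: funext => v; apply: tensorE.
by rewrite h; congr (_ *: _); apply: eq_extremal => l; rewrite mem_index_enum.
Qed.

Lemma E_F_adjoint n : adjoint (E n) (F (- n)).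
Proof.
move=> u v; rewrite tensorE tensorF.
apply: (@adjoint_sum K _ _ (index_enum 'I_k) (fun j => factor_op j (cur_e n))
  (fun j => factor_op j (cur_f (- n)))).
by move=> j; apply: factor_op_adjoint; [exact: e_linear|exact: f_linear|exact: e_f_adjoint].
Qed.
Lemma F_E_adjoint n : adjoint (F n) (E (- n)).
Proof. by apply: adjoint_sym; have := @E_F_adjoint (- n); rewrite opprK. Qed.
End Extremal.

Section Strings.
Variables (K : numFieldType) (V : lmodType K) (A : action V) (k : nat).
Hypothesis mA : is_module A.
Hypothesis level : forall u, cent A u = k%:R *: u.
Local Notation E := (loop A (sl2_e K)).
Local Notation F := (loop A (sl2_f K)).
Local Notation H := (loop A (sl2_h K)).
Variables (p : int) (N : nat) (w : V).
Hypothesis Fw : F (- p) w = 0.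
Hypothesis Hw : H 0 w = (p%:~R * k%:R - N%:R) *: w.

Lemma string_weight r : H 0 (iter r (E p) w) =
  (p%:~R * k%:R - N%:R + (2 * r)%N%:R) *: iter r (E p) w.
Proof.
elim: r => [|r IH] /=; first by rewrite muln0 addr0.
rewrite (swap_HE mA) IH add0r (linZ (loop_lin mA _ _)) mulnS addnC natrD.
by lmod_with K V.
Qed.

(** The sl_2-triple is e_p, f_{-p} and [e_p, f_{-p}] = h_0 - p k, for which [w] is a
    lowest weight vector of weight - N. *)
Lemma string_lower r : (r <= N)%N ->
  F (- p) (iter r.+1 (E p) w) = (r.+1 * (N - r))%N%:R *: iter r (E p) w.
Proof.
have FE u : F (- p) (E p u) = E p (F (- p) u) - H 0 u + (p%:~R * k%:R) *: u.
  have -> : E p (F (- p) u) = F (- p) (E p u) + H 0 u - (p%:~R * k%:R) *: u.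
    by rewrite (swap_EF mA level) subrr eqxx mulr1.
  by lmod_with K V.
elim: r => [|r IH] rN.
  rewrite /= FE Fw Hw (lin0 (loop_lin mA _ _)) subn0 mul1n; lmod_with K V.
rewrite iterS FE IH; last exact: ltnW.
rewrite string_weight (linZ (loop_lin mA _ _)) -iterS !natrM !natrB //; last exact: ltnW.
by rewrite -![r.+2]addn1 -![r.+1]addn1 !natrD; lmod_with K V.
Qed.

Lemma string_down r t : (r + t <= N)%N ->
  exists2 c : K, c != 0 & iter t (F (- p)) (iter (r + t) (E p) w) = c *: iter r (E p) w.
Proof.
elim: t => [|t IH] rt; first by exists 1; rewrite ?oner_neq0 // addn0 scale1r.
rewrite addnS in rt *; have [c c0 h] := IH (ltnW rt).
exists ((((r + t).+1 * (N - (r + t)))%N)%:R * c).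
  by rewrite mulf_neq0 // pnatr_eq0 muln_eq0 /= -lt0n subn_gt0.
rewrite iterSr string_lower; last exact: ltnW.
by rewrite (linZ (lin_iter _ (loop_lin mA _ _))) h scalerA.
Qed.
End Strings.

(** * The space L^D *)
Section LDspace.
Variables (K : numClosedFieldType) (k i : nat).
Hypotheses (hk : (1 <= k)%N) (hi : (i <= k)%N).
Local Notation FT := (Ftensor K k).
Local Notation T := (tensor_rep K k).
Local Notation E := (loop T (sl2_e K)).
Local Notation F := (loop T (sl2_f K)).
Local Notation H := (loop T (sl2_h K)).
Let D : 'I_k.+1 -> nat := fun j => nat_of_bool (nat_of_ord j == i).
(** In the notation v(m_1) (x) ... (x) v(m_k), the vector w_s has m_j = - b j - 2s
    and the highest weight vector has m_j = b j. *)
Let b (j : 'I_k) : int := (j < i)%N%:Z.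

Let mT : is_module T := @tensor_module K k.
Let lT x n : linear (loop T x n) := loop_lin mT x n.
Let level : forall v : FT, cent T v = k%:R *: v := @tensor_cent K k.

Local Notation w s := (LD_w K D s).
Local Notation M := (@LD_M K k D).
Local Notation LD := (@LD K k D).

Lemma b01 j : 0 <= b j <= 1.
Proof. by rewrite /b; case: (_ < _)%N. Qed.

Lemma sum_b : \sum_j b j = i%:Z.
Proof.
rewrite /b -[i in RHS](subnKC (leq0n i)) subn0 add0n.
rewrite -(big_mkord xpredT (fun j => (j < i)%N%:Z)) /=.
rewrite (big_cat_nat (leq0n i) hi) /= (eq_big_nat _ _ (F2 := fun=> 1)); last first.
  by move=> j /andP[_ ->].
rewrite [X in _ + X]big_nat [X in _ + X]big1 ?addr0; last first.
  by move=> j /andP[ij _]; rewrite ltnNge ij.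
by rewrite sumr_const_nat subn0 natz.
Qed.

Lemma LD_nE : LD_n D = 1%N.
Proof.
rewrite /LD_n (bigD1 (Ordinal (hi : (i < k.+1)%N))) //= /D eqxx big1 ?addn0 // => j ji.
by rewrite (_ : (j == i :> nat) = false) //; apply: contraNF ji => /eqP e; apply/eqP/val_inj.
Qed.

Lemma LD_betaE j : LD_beta D j = (j < i)%N.
Proof.
rewrite /LD_beta; have [ji|ij] := ltnP j i; last first.
  rewrite big1 // => l jl; rewrite /D (_ : (l == i :> nat) = false) //.
  by apply/negP => /eqP li; move: jl; rewrite li ltnNge ij.
rewrite (bigD1 (Ordinal (hi : (i < k.+1)%N))) //= /D eqxx big1 ?addn0 // => l /andP[_ li].
by rewrite (_ : (l == i :> nat) = false) //; apply: contraNF li => /eqP e; apply/eqP/val_inj.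
Qed.

Lemma LD_wE s : w s = extremal K (fun j => - b j - 2 * s%:Z).
Proof.
rewrite extremal.unlock; congr << _ >>; apply/ffunP => j.
by rewrite !ffunE LD_betaE PoszM.
Qed.

Definition in_range (s : nat) (a : int) := - (2 * s%:Z) <= a <= 0.

Lemma M_range s a : (- (LD_n D + 2 * s)%N%:Z + 1 <= a <= 0) = in_range s a.
Proof. by rewrite /in_range LD_nE; lia. Qed.

Lemma M_subspace s : subspace (M s).
Proof.
split.
- by exists [::]; rewrite big_nil.
- move=> _ _ [p [hp ->]] [q [hq ->]]; exists (p ++ q); rewrite big_cat; split=> // m.
  by rewrite mem_cat => /orP[/hp|/hq].
move=> a _ [p [hp ->]]; exists [seq (a * m.1, m.2) | m <- p]; split.
  by move=> _ /mapP[m /hp hm ->].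
by rewrite big_map scaler_sumr; apply: eq_bigr => m _; rewrite scalerA.
Qed.

Lemma M_w s : M s (w s).
Proof.
exists [:: (1, [::])]; split; last by rewrite big_seq1 scale1r.
by move=> m; rewrite inE => /eqP ->.
Qed.

Lemma e_monomial_cons a l v : e_monomial (a :: l) v = E a (e_monomial l v).
Proof. by rewrite tensor_rep.unlock. Qed.

Lemma M_E s a u : in_range s a -> M s u -> M s (E a u).
Proof.
move=> ra [p [hp ->]]; exists [seq (m.1, a :: m.2) | m <- p]; split.
  by move=> _ /mapP[m /hp hm ->] /=; rewrite M_range ra.
rewrite big_map (lin_sum (lT _ a)); apply: eq_bigr => m _.
by rewrite (linZ (lT _ a)) e_monomial_cons.
Qed.

Lemma M_min s (W : FT -> Prop) : subspace W -> W (w s) ->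
  (forall a u, in_range s a -> W u -> W (E a u)) -> forall u, M s u -> W u.
Proof.
move=> [W0 WD WZ] Ww WE u [p [hp ->]]; elim: p hp => [|m p IH] hp.
  by rewrite big_nil.
rewrite big_cons; apply: (WD).
  apply: (WZ); have := hp m (mem_head _ _); elim: m.2 => [//|a l IHl] /andP[ra al].
  by rewrite e_monomial_cons; apply: (WE); [rewrite -M_range|apply: IHl].
by apply: IH => m' m'p; apply: hp; rewrite inE m'p orbT.
Qed.

Lemma iter_closed (W : FT -> Prop) (X : FT -> FT) r u :
  (forall v, W v -> W (X v)) -> W u -> W (iter r X u).
Proof. by move=> WX Wu; elim: r => //= r; apply: WX. Qed.

Lemma subspace_unscale (W : FT -> Prop) c u : subspace W -> c != 0 -> W (c *: u) -> W u.
Proof. by case=> _ _ WZ c0 /(WZ c^-1); rewrite scalerA mulVf // scale1r. Qed.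

Lemma reflect_in (W : FT -> Prop) p m : subspace W -> (forall v, W v -> W (E p v)) ->
  (forall j, m j <= p) -> W (extremal K m) -> W (extremal K (fun j => 2 * p - m j)).
Proof.
move=> sW WE mp Wm; have [c c0 h] := reflect_E K mp.
by apply: (subspace_unscale sW c0); rewrite -h; apply: iter_closed.
Qed.

(** Reflecting w_{s+1} at - 2s - 2 and then at - 2s - 1 gives w_s, and both indices
    are among those allowed in M_{s+1}. *)
Lemma M_chain1 s u : M s u -> M s.+1 u.
Proof.
have sM := M_subspace s.+1.
apply: M_min => // [|a v ra]; last by apply: M_E; move: ra; rewrite /in_range; lia.
have Mw := M_w s.+1; rewrite LD_wE in Mw.
have ME p : - (2 * s.+1%:Z) <= p <= 0 -> forall v, M s.+1 v -> M s.+1 (E p v).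
  by move=> rp v; apply: M_E.
have p1 : - (2 * s.+1%:Z) <= - (2 * s.+1%:Z) <= 0 by lia.
have p2 : - (2 * s.+1%:Z) <= 1 - 2 * s.+1%:Z <= 0 by lia.
have h1 := reflect_in sM (ME _ p1) _ Mw.
have {}h1 := h1 (fun j => ltac:(have := b01 j; lia)).
have h2 := reflect_in sM (ME _ p2) _ h1.
have {}h2 := h2 (fun j => ltac:(have := b01 j; lia)).
rewrite LD_wE; move: h2; congr (M s.+1 _); apply: eq_extremal => j; lia.
Qed.

Lemma M_chain s t u : (s <= t)%N -> M s u -> M t u.
Proof.
move=> /subnK <- Mu; elim: (t - s)%N => [|r IH]; first exact: Mu.
by rewrite addSn; apply: M_chain1.
Qed.

Lemma LD_of_M s u : M s u -> LD u.
Proof. by move=> Mu; exists s.+1; [|exact: M_chain1]. Qed.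

Lemma LD_subspace : subspace LD.
Proof.
split.
- by have [M0 _ _] := M_subspace 0; apply: LD_of_M M0.
- move=> u v [s s1 Mu] [t t1 Mv]; have [_ MD _] := M_subspace (maxn s t).
  apply: (LD_of_M (s := maxn s t)); apply: MD.
    by apply: M_chain Mu; apply: leq_maxl.
  by apply: M_chain Mv; apply: leq_maxr.
by move=> a u [s s1 Mu]; have [_ _ MZ] := M_subspace s; exists s => //; apply: MZ.
Qed.

Lemma LD_E a u : a <= 0 -> LD u -> LD (E a u).
Proof.
move=> a0 [s s1 Mu]; apply: (LD_of_M (s := maxn s `|a|)).
by apply: M_E; [rewrite /in_range; lia|apply: M_chain Mu; apply: leq_maxl].
Qed.

Lemma LD_min (W : FT -> Prop) : subspace W -> (forall s, W (w s)) ->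
  (forall a u, a <= 0 -> W u -> W (E a u)) -> forall u, LD u -> W u.
Proof.
move=> sW Ww WE u [s _]; apply: M_min => // a v /andP[_ a0]; exact: WE.
Qed.

Lemma LD_w s : LD (w s). Proof. by apply: LD_of_M (M_w s). Qed.

(** The modes of h and f with n <= 0 act on each w_s by a scalar, and their
    commutators with the e_a, a <= 0, are of the same kind. *)
Lemma LD_HF u : LD u -> forall n, n <= 0 -> LD (H n u) /\ LD (F n u).
Proof.
have [L0 LDD LZ] := LD_subspace.
have LB u' v : LD u' -> LD v -> LD (u' - v).
  by move=> hu hv; apply: (LDD) => //; rewrite -scaleN1r; apply: LZ.
pose W u := LD u /\ forall n, n <= 0 -> LD (H n u) /\ LD (F n u).
suff Wu : forall u, LD u -> W u by move=> /Wu[].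
apply: LD_min => [|s|a v a0 [Lv hv]].
- split.
  + by split=> // n _; rewrite !(lin0 (lT _ n)).
  + move=> x y [hx hx'] [hy hy']; split=> [|n n0]; first exact: LDD.
    have [h1 h2] := hx' n n0; have [h3 h4] := hy' n n0.
    by rewrite !(linD (lT _ n)); split; apply: LDD.
  move=> a x [hx hx']; split=> [|n n0]; first exact: LZ.
  by have [h1 h2] := hx' n n0; rewrite !(linZ (lT _ n)); split; apply: LZ.
- split=> [|n n0]; first exact: LD_w.
  have Lw := LD_w s; rewrite LD_wE in Lw *; split; first by rewrite H_extremal //; apply: LZ.
  by rewrite F_extremal0 // => j; have := b01 j; lia.
split=> [|n n0]; first exact: LD_E.
have [h1 h2] := hv n n0; split.
  rewrite (swap_HE mT); apply: (LDD); first exact: LD_E.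
  by apply: (LZ); apply: LD_E => //; lia.
have := swap_EF mT level a n v; set X := H _ v; set c := _ *: v => h.
have -> : F n (E a v) = E a (F n v) - (X - c) by rewrite h -[_ + X - c]addrA addrK.
have an0 : a + n <= 0 by lia.
have [h3 _] := hv _ an0.
by apply: (LB); [apply: LD_E|apply: (LB); [exact: h3|apply: LZ]].
Qed.

(** The vector is the reflection of w_s at 0. *)
Lemma LD_extremal_up s : LD (extremal K (fun j => b j + 2 * s%:Z)).
Proof.
have Lw := LD_w s; rewrite LD_wE in Lw.
have := reflect_in LD_subspace (fun v => @LD_E 0 v (lexx 0)) _ Lw.
move=> /(_ (fun j => ltac:(have := b01 j; lia))) h.
by rewrite (eq_extremal K (m' := fun j => 2 * 0 - (- b j - 2 * s%:Z))) // => j; lia.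
Qed.

Lemma LD_hw : LD (extremal K b).
Proof. by have := LD_extremal_up 0; rewrite (eq_extremal K (m' := b)) // => j; lia. Qed.

Lemma weight_w (p : int) (m : 'I_k -> int) : (forall j, m j <= p) ->
  H 0 (extremal K m) = (p%:~R * k%:R - (\sum_j `|(p - m j)%R|)%N%:R) *: extremal K m.
Proof.
move=> mp; rewrite H_extremal // eqxx mul1r; congr (_ *: _).
have -> : (\sum_j `|(p - m j)%R|)%N%:R = \sum_j (p - m j)%:~R :> K.
  rewrite natr_sum; apply: eq_bigr => j _; have := mp j => mpj.
  by rewrite natr_absz ger0_norm // subr_ge0.
rewrite -rmorph_sum sumrB rmorphB /= sumr_const card_ord.
by rewrite rmorphMn /= -[p%:~R *+ k]mulr_natr subKr.
Qed.

(** The reflections of w_s at 1 and of w_{s+1} at 0 are the same vector; going down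
    its string for f_{-1} until the last but one step gives e_1 w_s. *)
Lemma LD_E1w s : LD (E 1 (w s)).
Proof.
rewrite LD_wE; set m := fun j => _.
have mp j : m j <= 1 by rewrite /m; have := b01 j; lia.
have [c c0 h] := reflect_E K mp.
pose N := (\sum_j `|(1 - m j)%R|)%N.
have N0 : (1 + N.-1 = N)%N.
  rewrite add1n prednK // /N (bigD1 (Ordinal hk)) //= addn_gt0 absz_gt0.
  by rewrite /m; have := b01 (Ordinal hk); lia.
have F0 : F (- 1) (extremal K m) = 0.
  by apply: F_extremal0 => j; rewrite /m; have := b01 j; lia.
have N1 : (1 + N.-1 <= N)%N by rewrite N0.
have [d d0] := string_down mT level F0 (weight_w mp) N1.
rewrite N0 h => hd; apply: (subspace_unscale LD_subspace d0); rewrite -[iter 1 _ _]/(E 1 _) in hd.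
rewrite -hd; apply: iter_closed => [v Lv|].
  by have [] := LD_HF Lv (n := -1) isT.
have [_ _ LZ] := LD_subspace; apply: LZ.
have := LD_extremal_up s.+1; rewrite (eq_extremal K (m' := fun j => 2 * 1 - m j)) // => j.
by rewrite /m; lia.
Qed.

Lemma LD_E1 u : LD u -> LD (E 1 u).
Proof.
apply: (LD_min (W := fun u => LD (E 1 u))) => [|s|a v a0 Lv].
- exact: preim_subspace (lT _ 1) LD_subspace.
- exact: LD_E1w.
by rewrite (rel_EE mT); apply: LD_E.
Qed.

Lemma LD_submodule : is_submodule T LD.
Proof.
have [L0 LDD LZ] := LD_subspace.
apply: (submodule_gen mT) => //.
- by move=> v Lv; rewrite level; apply: LZ.
- by move=> v; apply: LD_E.
- by move=> v Lv; have [] := LD_HF Lv (lexx 0).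
- exact: LD_E1.
- by move=> v Lv; have [] := LD_HF Lv (n := -1) isT.
by rewrite pnatr_eq0.
Qed.

Lemma extremal_hw : is_hw T i (extremal K b).
Proof.
split=> [n n0|n n0|].
- by apply: E_extremal0 => j; have := b01 j; lia.
- split; first by apply: F_extremal0 => j; have := b01 j; lia.
  by rewrite H_extremal ?ltW // lt_eqF // mul0r scale0r.
by rewrite H_extremal // eqxx mul1r sum_b.
Qed.

Lemma unreflect_in (W : FT -> Prop) p m : is_submodule T W -> (forall j, m j <= p) ->
  W (extremal K (fun j => 2 * p - m j)) -> W (extremal K m).
Proof.
move=> sW mp Wm; have [c c0 h] := reflect_E K mp.
have F0 : F (- p) (extremal K m) = 0 by apply: F_extremal0 => j; have := mp j; lia.
have [d d0] := string_down mT level F0 (weight_w mp) (leqnn (0 + _)).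
rewrite add0n h => hd.
have sub : subspace W := submodule_subspace sW.
have [_ _ WZ Wl _] := sW.
apply: (subspace_unscale sub d0); rewrite -[X in _ *: X]/(iter 0 (E p) _) -hd.
by apply: iter_closed; [move=> v; apply: Wl|apply: WZ].
Qed.

(** The reflections that lead from the w_s to the highest weight vector are
    inverted inside any submodule. *)
Lemma hw_generates (W : FT -> Prop) : is_submodule T W -> W (extremal K b) ->
  forall u, LD u -> W u.
Proof.
move=> sW Wb; have [_ _ _ Wl _] := sW.
apply: LD_min => [|s|a u _]; [exact: submodule_subspace sW| |exact: Wl].
elim: s => [|s IH]; rewrite LD_wE.
  apply: (@unreflect_in _ 0) => // [j|]; first by have := b01 j; lia.
  by rewrite (eq_extremal K (m' := b)) // => j; lia.
rewrite LD_wE in IH.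
apply: (@unreflect_in _ (- 2 * s.+1%:Z)) => // [j|]; first by have := b01 j; lia.
apply: (@unreflect_in _ (1 - 2 * s.+1%:Z)) => // [j|]; first by have := b01 j; lia.
by move: IH; rewrite (eq_extremal K (m' := fun j => - b j - 2 * s%:Z)) // => j; lia.
Qed.

Lemma LD_span u : LD u -> span_of (mon T ^~ (extremal K b)) u.
Proof.
have sub := mon_span_submodule mT level extremal_hw; apply: (hw_generates sub).
exact: (span_gen (mon T ^~ (extremal K b)) [::]).
Qed.

Lemma mon_adjoint (W : FT -> Prop) u l v : is_submodule T W -> W u ->
  hform u (mon T l v) != 0 -> exists2 u', W u' & hform u' v != 0.
Proof.
move=> [_ _ _ Wl _]; elim: l u => [|[] l IH] u Wu /= h; first by exists u.
  by apply: (IH (F (-1) u)); [apply: Wl|rewrite F_E_adjoint].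
by apply: (IH (E 0 u)); [apply: Wl|rewrite E_F_adjoint oppr0].
Qed.

(** A nonzero [u] in [W] is not orthogonal to L^D, hence not to some monomial
    applied to the highest weight vector; moving the monomial to the other side
    gives an element of [W] whose component of degree 0 is nonzero. *)
Lemma LD_irreducible (W : FT -> Prop) : is_submodule T W -> (forall u, W u -> LD u) ->
  (forall u, W u -> u = 0) \/ (forall u, LD u -> W u).
Proof.
move=> sW WL; have [W0|] := pselect (forall u, W u -> u = 0); first by left.
move=> /existsNP[u /not_implyP[Wu u0]]; right; apply: hw_generates => //.
pose v := extremal K b; have hv := extremal_hw.
have [l hl] : exists l, hform u (mon T l v) != 0.
  apply: contrapT => /forallNP h; apply: u0; apply: hform_eq0.
  apply: (span_min (W := fun x => hform u x = 0) _ _ (LD_span (WL _ Wu))).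
    split=> [|x y hx hy|a x hx]; first exact: hform0r.
      by rewrite hformDr hx hy addr0.
    by rewrite hformZr hx mulr0.
  by move=> l; apply/eqP/negPn/negP; apply: h.
have [n Wn] := mon_adjoint sW Wu hl.
have [p pE] := LD_span (WL _ Wn).
pose c := \sum_(m <- p | m.2 == [::]) m.1.
pose q := [seq m <- p | m.2 != [::]].
have nE : n = c *: v + \sum_(m <- q) m.1 *: mon T m.2 v.
  rewrite pE (bigID (fun m => m.2 == [::])) /= big_filter; congr (_ + _).
  by rewrite scaler_suml; apply: eq_bigr => m /eqP ->.
have [E0 FH0 _] := hv.
have orth l' : l' != [::] -> hform (mon T l' v) v = 0.
  case: l' => [//|[] l'] _ /=.
    by rewrite E_F_adjoint; have [-> _] := FH0 (-1) isT; rewrite hform0r.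
  by rewrite F_E_adjoint oppr0 E0 // hform0r.
have hn : hform n v = c * hform v v.
  have lh := @hform_lin K _ v.
  rewrite nE hformDl hformZl (lin_sum lh) big1_seq ?addr0 // => m /andP[_].
  by rewrite mem_filter => /andP[m0 _]; rewrite hformZl orth ?mulr0.
rewrite hn => cn.
have c0 : c != 0 by apply: contraNneq cn => ->; rewrite mul0r.
apply: (subspace_unscale (submodule_subspace sW) c0).
apply: (leading_component mT level sW hv _ _ (p := q)).
- by move=> N; rewrite (linZ (pdegree_linear k i mT N)) (pdegree_hw k mT N hv) scaler0.
- by move=> m; rewrite mem_filter => /andP[].
by rewrite -nE.
Qed.
End LDspace.

(** * L^D as a module and the theorem *)
Section SubAction.
Variables (K : fieldType) (V : lmodType K) (A : action V) (W : V -> Prop).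
Hypothesis sW : is_submodule A W.

(** The proof that [W] is a submodule is a phantom argument, from which the
    linear structure on the subtype is inferred. *)
Definition sub_pred of is_submodule A W : {pred V} := fun v => `[< W v >].
Local Notation P := (sub_pred sW).

Lemma sub_predP v : reflect (W v) (v \in P).
Proof. exact: asboolP. Qed.

Fact sub_pred_closed : submod_closed P.
Proof.
have [W0 WD WZ _ _] := sW.
split=> [|a u v /sub_predP Wu /sub_predP Wv]; apply/sub_predP => //.
by apply: (WD) => //; apply: WZ.
Qed.
HB.instance Definition _ := GRing.isSubmodClosed.Build K V P sub_pred_closed.

Record subrep := Subrep { subrep_val :> V; subrepP : subrep_val \in P }.
HB.instance Definition _ := [isSub for subrep_val].
HB.instance Definition _ := [Choice of subrep by <:].
HB.instance Definition _ := [SubChoice_isSubLmodule of subrep by <:].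

Lemma subrep_in (v : subrep) : W v.
Proof. exact/sub_predP/subrepP. Qed.
Lemma subrep_loop x n (v : subrep) : loop A x n v \in P.
Proof. by apply/sub_predP; case: sW => _ _ _ Wl _; apply: Wl; apply: subrep_in. Qed.
Lemma subrep_cent (v : subrep) : cent A v \in P.
Proof. by apply/sub_predP; case: sW => _ _ _ _; apply; apply: subrep_in. Qed.

Definition sub_action : action (subrep : lmodType K) :=
  Action (fun x n v => Subrep (subrep_loop x n v)) (fun v => Subrep (subrep_cent v)).

Lemma sub_module : is_module A -> is_module sub_action.
Proof.
move=> mA; split=> [x n a u v|a u v|n v a x y|x n v|x y m n v]; apply: val_inj => /=.
- exact: loop_linear.
- exact: cent_linear.
- exact: loop_linear_sl2.
- exact: cent_central.
exact: (loop_bracket mA).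
Qed.

Lemma sub_submodule (U : subrep -> Prop) : is_submodule sub_action U ->
  is_submodule A (fun v => exists2 u : subrep, U u & v = u).
Proof.
move=> [U0 UD UZ Ul Uc]; split.
- by exists 0.
- by move=> _ _ [u Uu ->] [v Uv ->]; exists (u + v); first exact: UD.
- by move=> a _ [u Uu ->]; exists (a *: u); first exact: UZ.
- by move=> x n _ [u Uu ->]; exists (loop sub_action x n u); first exact: Ul.
by move=> _ [u Uu ->]; exists (cent sub_action u); first exact: Uc.
Qed.
End SubAction.

Section Final.
Variables (K : numClosedFieldType) (k i : nat).
Hypotheses (hk : (1 <= k)%N) (hi : (i <= k)%N).
Let D : 'I_k.+1 -> nat := fun j => nat_of_bool (nat_of_ord j == i).
Let sL : is_submodule (tensor_rep K k) (LD (K := K) D) := LD_submodule K hk hi.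

Lemma LD_is_L : is_L i k (sub_action sL).
Proof.
have mT := @tensor_module K k.
have [E0 FH0 h0] := extremal_hw K hk hi; set v := extremal K _ in E0 FH0 h0.
have Pv : v \in sub_pred sL by apply/sub_predP; apply: LD_hw.
have subE (U : subrep sL -> Prop) (u : subrep sL) :
    (exists2 u' : subrep sL, U u' & (u : Ftensor K k) = u') -> U u.
  by case=> u' Uu' uu'; rewrite (_ : u = u') //; apply: val_inj.
split; first exact: sub_module.
- split.
    exists (Subrep Pv) => /(congr1 (@subrep_val _ _ _ _ sL)) /= v0.
    have := hformUU K (vacs (fun j : 'I_k => (j < i)%N%:Z)) (vacs (fun j : 'I_k => (j < i)%N%:Z)).
    move: v0; rewrite /v extremal.unlock => ->; rewrite hform0l eqxx => /eqP.
    by rewrite eq_sym oner_eq0.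
  move=> U sU; have sU' := sub_submodule sU.
  have UL (u : Ftensor K k) : (exists2 u' : subrep sL, U u' & u = u') -> LD (K := K) D u.
    by case=> u' _ ->; apply: subrep_in.
  have [h|h] := LD_irreducible hk hi sU' UL; [left=> u Uu|right=> u].
    by apply: val_inj; apply: h; exists u.
  by apply: subE; apply: h; apply: subrep_in.
exists (Subrep Pv); split.
- move=> U sU Uv u; apply: subE; apply: (hw_generates hk hi (sub_submodule sU)).
    by exists (Subrep Pv).
  exact: subrep_in.
- by move=> n n0; apply: val_inj; apply: E0.
- by move=> n n0; have [f0 h1] := FH0 n n0; split; apply: val_inj.
- by apply: val_inj; apply: tensor_cent.
by apply: val_inj.
Qed.
End Final.

Theorem corollary3p1 (R : realType) (k i : nat) (hk : (1 <= k)%N)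
    (hi : (i <= k)%N) :
  let D : 'I_k.+1 -> nat := fun j => nat_of_bool (nat_of_ord j == i) in
  (exists (V : lmodType R[i]) (A : action V), is_L i k A) /\
  (forall (V : lmodType R[i]) (A : action V), is_L i k A ->
     iso_onto A (tensor_action R[i] k) (LD (K := R[i]) D)).
Proof.
move=> D; have LL := LD_is_L R[i] hk hi.
split; first by eexists; eexists; exact: LL.
move=> V A LA; have [g [ginj gsur gl gc]] := L_unique LA LL.
pose f v : Ftensor R[i] k := g v.
have lf : linear f by move=> a u v; rewrite /f linearP.
have -> : tensor_action R[i] k = tensor_rep R[i] k by rewrite tensor_rep.unlock.
exists (mk_linear lf); rewrite /mk_linear; split.
- by move=> u v e; apply: ginj; apply: val_inj.
- by move=> x n v; apply: (congr1 (@subrep_val _ _ _ _ _) (gl x n v)).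
- by move=> v; apply: (congr1 (@subrep_val _ _ _ _ _) (gc v)).
move=> w; split=> [Lw|[v ->]]; last exact: subrep_in.
have Pw : w \in sub_pred (LD_submodule R[i] hk hi) by apply/sub_predP.
by have [v e] := gsur (Subrep Pw); exists v; exact: (congr1 (@subrep_val _ _ _ _ _) e).
Qed.
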